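(* Let $\mathcal{T}$ be a trajectory of the billiard within the ellipsoid $\mathcal{E}=\mathcal{Q}_0$ in the pseudo-Euclidean space $\mathbf{E}^{k,l}$. Denote by $\alpha_1,\dots,\alpha_{d-1}$ the parameters of the caustics of $\mathcal{T}$ from the confocal family $(\mathcal{Q}_\lambda)$, and write $$\{b_1,\dots,b_p,c_1,\dots,c_q\}=\{\varepsilon_1a_1,\dots,\varepsilon_da_d,\alpha_1,\dots,\alpha_{d-1}\}$$ (as multisets) with $c_q\le\dots\le c_2\le c_1<0<b_1\le b_2\le\dots\le b_p$, $p+q=2d-1$. Then: \begin{itemize} \item[(PE3)] along $\mathcal{T}$, each generalized Jacobi coordinate takes values in exactly one of the segments $$[c_{2l-1},c_{2l-2}],\ \dots,\ [c_3,c_2],\ [c_1,0],\ [0,b_1],\ [b_2,b_3],\ \dots,\ [b_{2k-2},b_{2k-1}];$$ \item[(PE4)] along $\mathcal{T}$, each generalized Jacobi coordinate can achieve local minima and maxima only at touching points with corresponding caustics, intersection points with corresponding coordinate hyperplanes, and at reflection points; \item[(PE5)] values of generalized Jacobi coordinates at critical points are $0,b_1,\dots,b_{2k-1},c_1,\dots,c_{2l-1}$; between the critical points, the coordinates are changed monotonously. \end{itemize}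
   Context: Let $k,l\ge1$, $d=k+l$. The pseudo-Euclidean space $\mathbf{E}^{k,l}$ is $\mathbf{R}^d$ with the scalar product $\langle x,y\rangle_{k,l}=x_1y_1+\dots+x_ky_k-x_{k+1}y_{k+1}-\dots-x_dy_d$; $\circ$ denotes the standard Euclidean product. Put $\varepsilon_i=1$ for $i\le k$, $\varepsilon_i=-1$ for $i>k$. Fix positive constants with $a_1>\dots>a_k>0>-a_{k+1}>\dots>-a_d$. The confocal family is $\mathcal{Q}_\lambda:\ \sum_{i=1}^d\frac{x_i^2}{a_i-\varepsilon_i\lambda}=1$, $\lambda\in\mathbf{R}$, where $\mathcal{Q}_{\varepsilon_ia_i}$ is understood as the coordinate hyperplane $x_i=0$, together with the hyperplane at infinity $\mathcal{Q}_\infty$; $\mathcal{E}=\mathcal{Q}_0$. The generalized Jacobi coordinates of a point $x$ are the unordered $d$-tuple of solutions $\lambda$ of $\sum_i\frac{x_i^2}{a_i-\varepsilon_i\lambda}=1$ (roots of the polynomial obtained by clearing denominators). Billiard reflection of a vector $v$ on a hyperplane $\alpha$: decompose $v=u+n_\alpha$ with $u$ in $\alpha$ and $n_\alpha$ orthogonal to $\alpha$ with respect to $\langle\cdot,\cdot\rangle_{k,l}$; the reflected vector is $v'=u-n_\alpha$. Billiard motion within $\mathcal{E}$ is uniform and straight inside $\mathcal{E}$ and obeys this reflection law with respect to the tangent hyperplane of $\mathcal{E}$ at boundary points; at points where the tangent hyperplane contains its orthogonal vector, $v$ is reflected into $-v$. With $A_\lambda=\mathrm{diag}\left(\frac1{a_i-\varepsilon_i\lambda}\right)$,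 the line $x+tv$ is tangent to $\mathcal{Q}_\lambda$ if $(A_\lambda x\circ v)^2-(A_\lambda v\circ v)(A_\lambda x\circ x-1)=0$; the left-hand side equals $\mathcal{P}(\lambda)/\prod_i(a_i-\varepsilon_i\lambda)$ with $\mathcal{P}$ a polynomial regarded as having degree $d-1$, with roots counted with multiplicity and missing roots (for light-like lines, i.e. $\langle v,v\rangle_{k,l}=0$) equal to $\infty$, which is counted as larger than every real number. All segments of a billiard trajectory within $\mathcal{E}$ are tangent to the same $d-1$ quadrics $\mathcal{Q}_{\alpha_1},\dots,\mathcal{Q}_{\alpha_{d-1}}$ (the $\alpha_j$ being the roots of $\mathcal{P}$), called the caustics of the trajectory.
   Formalization: (PE5) values: excepted are reflection points whose tangent hyperplane contains its orthogonal vector (v goes to -v), for coordinates outside [0,b_1], [c_1,0]; (PE3) ''exactly one'' excepts a coordinate constant along the trajectory. Both clauses are false there. *)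

(* Defs.v *)
From mathcomp Require Import all_boot all_order all_algebra.
From mathcomp Require Import all_classical all_reals all_analysis.

Set Implicit Arguments.
Unset Strict Implicit.
Unset Printing Implicit Defensive.

Import Order.TTheory GRing.Theory Num.Theory.
Import numFieldNormedType.Exports.

Local Open Scope classical_set_scope.
Local Open Scope ring_scope.

(* Coordinates are indexed from 0: eps i = 1 for the first k of them. *)
Definition eps (R : realType) (k l : nat) (i : 'I_(k + l)) : R :=
  if (i < k)%N then 1 else -1.

Definition pe_dot (R : realType) (k l : nat) (x y : 'rV[R]_(k + l)) : R :=
  \sum_i eps R i * x 0 i * y 0 i.

(* qform a lam x y is (A_lam x) o y, where A_lam = diag (1 / (a_i - eps_i lam));
   it is meaningful when [regular a lam] holds. *)
Definition qform (R : realType) (k l : nat) (a : 'I_(k + l) -> R) (lam : R)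
    (x y : 'rV[R]_(k + l)) : R :=
  \sum_i x 0 i * y 0 i / (a i - eps R i * lam).

Definition regular (R : realType) (k l : nat) (a : 'I_(k + l) -> R)
    (lam : R) : Prop :=
  forall i, a i - eps R i * lam != 0.

(* The ellipsoid is Q_0, i.e. [qform a 0 x x = 1]; this is the direction space
   of its tangent hyperplane at y. *)
Definition tangent_hyperplane (R : realType) (k l : nat) (a : 'I_(k + l) -> R)
    (y : 'rV[R]_(k + l)) : set 'rV[R]_(k + l) :=
  [set u | qform a 0 y u = 0].

Definition pe_orthogonal (R : realType) (k l : nat) (H : set 'rV[R]_(k + l))
    (n : 'rV[R]_(k + l)) : Prop :=
  forall u, H u -> pe_dot n u = 0.

Definition singular_hyperplane (R : realType) (k l : nat)
    (H : set 'rV[R]_(k + l)) : Prop :=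
  exists n, [/\ n != 0, H n & pe_orthogonal H n].

Definition reflects (R : realType) (k l : nat) (H : set 'rV[R]_(k + l))
    (v v' : 'rV[R]_(k + l)) : Prop :=
  exists u n, [/\ H u, pe_orthogonal H n, v = u + n & v' = u - n].

Definition billiard_law (R : realType) (k l : nat) (H : set 'rV[R]_(k + l))
    (v v' : 'rV[R]_(k + l)) : Prop :=
  (singular_hyperplane H -> v' = - v) /\
  (~ singular_hyperplane H -> reflects H v v').

(* The reflection times tau n are indexed by the integers; between tau n and
   tau (n + 1) the velocity is v n.  The values of pos outside [lifetime] are
   irrelevant. *)
Record billiard_trajectory (R : realType) (k l : nat) (a : 'I_(k + l) -> R)
    (tau : int -> R) (v : int -> 'rV[R]_(k + l))
    (pos : R -> 'rV[R]_(k + l)) : Prop := BilliardTrajectory {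
  tau_increasing : forall n : int, tau n < tau (n + 1);
  velocity_neq0 : forall n : int, v n != 0;
  uniform_motion : forall (n : int) (t : R), tau n <= t <= tau (n + 1) ->
    pos t = pos (tau n) + (t - tau n) *: v n;
  inside_ellipsoid : forall (n : int) (t : R), tau n < t < tau (n + 1) ->
    qform a 0 (pos t) (pos t) < 1;
  on_ellipsoid : forall n : int, qform a 0 (pos (tau n)) (pos (tau n)) = 1;
  reflection : forall n : int,
    billiard_law (tangent_hyperplane a (pos (tau (n + 1)))) (v n) (v (n + 1))
}.

Definition lifetime (R : realType) (tau : int -> R) : set R :=
  [set t | exists n : int, tau n <= t <= tau (n + 1)].

(* s lists all the roots of p, with multiplicity; in particular p splits over
   the reals. *)
Definition roots_of (R : realType) (p : {poly R}) (s : seq R) : Prop :=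
  p != 0 /\ p = lead_coef p *: \prod_(r <- s) ('X - r%:P).

Definition jacobi_poly (R : realType) (k l : nat) (a : 'I_(k + l) -> R)
    (x : 'rV[R]_(k + l)) : {poly R} :=
  \prod_i ((a i)%:P - eps R i *: 'X)
  - \sum_i (x 0 i ^+ 2) *: \prod_(j | j != i) ((a j)%:P - eps R j *: 'X).

Definition jacobi_coordinates (R : realType) (k l : nat) (a : 'I_(k + l) -> R)
    (x : 'rV[R]_(k + l)) (mu : 'I_(k + l) -> R) : Prop :=
  roots_of (jacobi_poly a x) [seq mu i | i <- enum 'I_(k + l)].

Definition tangency_form (R : realType) (k l : nat) (a : 'I_(k + l) -> R)
    (lam : R) (x v : 'rV[R]_(k + l)) : R :=
  qform a lam x v ^+ 2 - qform a lam v v * (qform a lam x x - 1).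

Definition tangency_poly (R : realType) (k l : nat) (a : 'I_(k + l) -> R)
    (x v : 'rV[R]_(k + l)) (P : {poly R}) : Prop :=
  forall lam, regular a lam ->
    tangency_form a lam x v = P.[lam] / \prod_i (a i - eps R i * lam).

(* alpha lists d - 1 parameters; those not accounted for by roots of the
   tangency polynomial are +oo. *)
Definition line_caustics (R : realType) (k l : nat) (a : 'I_(k + l) -> R)
    (x v : 'rV[R]_(k + l)) (alpha : (k + l).-1.-tuple (\bar R)) : Prop :=
  (-oo%E \notin alpha) /\
  exists P, tangency_poly a x v P /\
    roots_of P [seq fine y | y <- alpha & y != +oo%E].

Definition trajectory_caustics (R : realType) (k l : nat)
    (a : 'I_(k + l) -> R) (tau : int -> R) (v : int -> 'rV[R]_(k + l))
    (pos : R -> 'rV[R]_(k + l)) (alpha : (k + l).-1.-tuple (\bar R)) : Prop :=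
  forall n : int, line_caustics a (pos (tau n)) (v n) alpha.

(* The line x + t v is tangent to Q_lam at the point x. *)
Definition touches_at (R : realType) (k l : nat) (a : 'I_(k + l) -> R)
    (lam : R) (x v : 'rV[R]_(k + l)) : Prop :=
  [/\ regular a lam, qform a lam x x = 1 & qform a lam x v = 0].

(* With b_0 = c_0 = 0, the j-th of the d segments is [b_(2j), b_(2j+1)] for
   j < k and [c_(2i+1), c_(2i)] for j = k + i. *)
Definition segment (R : realType) (k l : nat) (b c : seq (\bar R))
    (j : 'I_(k + l)) : set R :=
  match fintype.split j with
  | inl i => [set r : R | (nth 0%E (0%E :: b) i.*2 <= r%:E)%E /\
                          (r%:E <= nth 0%E (0%E :: b) i.*2.+1)%E]
  | inr i => [set r : R | (nth 0%E (0%E :: c) i.*2.+1 <= r%:E)%E /\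
                          (r%:E <= nth 0%E (0%E :: c) i.*2)%E]
  end.

(* 0, b_1, ..., b_(2k-1), c_1, ..., c_(2l-1) *)
Definition critical_values (R : realType) (k l : nat) (b c : seq (\bar R)) :
    seq (\bar R) :=
  0%E :: take k.*2.-1 b ++ take l.*2.-1 c.

Definition local_extremum (R : realType) (f : R -> R) (t : R) : Prop :=
  (\forall s \near t, f s <= f t) \/ (\forall s \near t, f t <= f s).

Definition critical_time (R : realType) (f : R -> R) (t : R) : Prop :=
  local_extremum f t \/ is_derive t (1 : R) f 0.

Definition strictly_monotone_on (R : realType) (f : R -> R) (s t : R) : Prop :=
  (forall u w, s <= u -> u < w -> w <= t -> f u < f w) \/
  (forall u w, s <= u -> u < w -> w <= t -> f w < f u).

(* Main.v *)
Require Import Defs.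
From mathcomp Require Import all_boot all_order all_algebra.
From mathcomp Require Import all_classical all_reals all_analysis.
From mathcomp Require Import ring lra zify.

(** Let [F mu x = 1 - sum_i x_i^2 / (a_i - eps_i mu)] and [e_i = eps_i a_i].  The
    Jacobi polynomial of a point of the ellipsoid alternates in sign, weakly,
    along [e_1 > ... > e_k > 0 > e_{k+1} > ... > e_d], so it has one root [L_i] in
    each closed gap between consecutive points, and
    [F mu x = prod_i (L_i - mu) / (e_i - mu)].  For [mu] inside the [i]-th gap the
    sign of [F mu x] therefore tells on which side of [mu] the root [L_i] lies.
    With [mu] fixed, [F mu] is quadratic in time along a segment of the
    trajectory; choosing [mu = L_i(t)] shows that [L_i] can be critical at [t]
    only where the slope of this quadratic, [-2 (A_mu x o v)], vanishes, i.e.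
    where the line touches [Q_mu].
    At a regular reflection the slope is the same on both sides, because the
    pseudo-normal of [Q_mu] at [x] is tangent to the ellipsoid; at a singular one,
    [0] is a double root of the Jacobi polynomial.

    For (PE3), let [Pi = prod_i (a_i - eps_i mu)]; the tangency polynomial [P]
    satisfies [P Pi = W^2 + V J] with [J] the Jacobi polynomial, so [P] has the
    sign of [Pi] at the roots of [J] and alternates along them.  Hence there are
    at least [k - 1] positive and [l - 1] negative caustics; as there are at most
    [d - 1] in all, parity forces exactly [j] of them between [0] and the [j]-th
    positive root, and likewise on the negative side.  When some [e_i]
    is a simple or double root of [J], a common factor is cancelled first. *)

Set Implicit Arguments.
Unset Strict Implicit.
Unset Printing Implicit Defensive.

Import Order.TTheory GRing.Theory Num.Theory.
Import numFieldNormedType.Exports.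

Local Open Scope classical_set_scope.
Local Open Scope ring_scope.

(** * Weakly alternating polynomials *)

(** If [q] were nonzero, the nonzero polynomial [p * q] would vanish at every natural number, hence
    have more roots than its degree permits. *)
Lemma poly_eq0_off (R : numDomainType) (p q : {poly R}) :
  p != 0 -> (forall x, p.[x] != 0 -> q.[x] = 0) -> q = 0.
Proof.
move=> p0 pq; apply/eqP/negPn/negP => q0.
have pq0 : p * q != 0 by rewrite mulf_neq0.
have rts : all (root (p * q)) [seq n%:R | n <- iota 0 (size (p * q))].
  apply/allP => _ /mapP[n _ ->]; apply/rootP; rewrite hornerM.
  by have [->|/pq ->] := eqVneq p.[n%:R] 0; rewrite (mul0r, mulr0).
suff /(max_poly_roots pq0 rts) : uniq [seq n%:R : R | n <- iota 0 (size (p * q))].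
  by rewrite size_map size_iota ltnn.
by rewrite map_inj_uniq ?iota_uniq // => i j /eqP; rewrite eqr_nat => /eqP.
Qed.

Lemma poly_ext (R : numDomainType) (p q : {poly R}) :
  (forall x, p.[x] = q.[x]) -> p = q.
Proof.
move=> pq; apply/eqP; rewrite -subr_eq0; apply/eqP.
apply: (@poly_eq0_off _ 1); first exact: oner_neq0.
by move=> x _; rewrite hornerD hornerN pq subrr.
Qed.

(* Peeling off the top root: when [y 1] is itself a root, the quotient by
   ['X - y 1] decides whether it may be chosen or a larger root exists. *)
Lemma weakly_alternating_roots (R : realType) (d : nat) (p : {poly R})
    (y : nat -> R) :
  size p = d.+1 -> (forall i, (i < d)%N -> y i.+1 < y i) ->
  (forall i, (i <= d)%N -> 0 <= (-1) ^+ i * p.[y i]) ->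
  exists z : nat -> R,
    (forall i, (i < d)%N -> y i.+1 <= z i <= y i) /\
    p = lead_coef p *: \prod_(i < d) ('X - (z i)%:P).
Proof.
elim: d p y => [|d IH] p y szp ydec sgn.
  exists y; split=> //; rewrite big_ord0.
  have /eqP := szp; move/eqP/eqP; rewrite eqn_leq => /andP[/size1_polyC pE _].
  by rewrite pE lead_coefC -mul_polyC mulr1.
suff [z [q [zy pE sq]]] : exists z q, [/\ y 1%N <= z <= y 0%N,
    p = q * ('X - z%:P) & forall i, (i <= d)%N -> 0 <= (-1) ^+ i * q.[y i.+1]].
  have q0 : q != 0.
    by apply/eqP => q0; move: szp; rewrite pE q0 mul0r size_poly0.
  have szq : size q = d.+1.
    by move: szp; rewrite pE size_Mmonic ?monicXsubC // size_XsubC addn2 => -[].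
  have [|w [wy qE]] := IH q (fun i => y i.+1) szq _ sq.
    by move=> i id; apply: ydec.
  exists (fun i => if i is i'.+1 then w i' else z); split.
    by case=> [|i] // id; apply: wy.
  by rewrite big_ord_recl /= {1}pE {1}qE pE lead_coef_Mmonic ?monicXsubC //
             -scalerAl mulrC.
have p0 : 0 <= p.[y 0%N] by have := sgn 0%N isT; rewrite expr0 mul1r.
have p1 : p.[y 1%N] <= 0.
  by have := sgn 1%N isT; rewrite expr1 mulN1r oppr_ge0.
have y10 : y 1%N < y 0%N by apply: ydec.
have ylt i : (i <= d)%N -> y i.+1 <= y 1%N.
  elim: i => // i IHi id; apply: le_trans (IHi (ltnW id)).
  by apply/ltW/ydec; lia.
(* Dividing by ['X - z] flips the sign at each node below [z], which absorbs the shift of the index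
   by one; only [y 1] can coincide with [z], hence the disjunction. *)
have signs z q : p = q * ('X - z%:P) -> y 1%N <= z -> 0 <= q.[y 1%N] \/ y 1%N < z ->
    forall i, (i <= d)%N -> 0 <= (-1) ^+ i * q.[y i.+1].
  move=> pE yz h i id.
  have pos j : (j <= d)%N -> y j.+1 < z -> 0 <= (-1) ^+ j * q.[y j.+1].
    move=> jd yjz; have := sgn j.+1 jd.
    rewrite pE hornerM hornerXsubC exprS mulrA -!mulrA mulN1r mulrA.
    rewrite -mulrN opprB pmulr_lge0 ?subr_gt0 //.
  case: i id => [|i] id.
    case: h => [|yz']; first by rewrite expr0 mul1r.
    exact: pos.
  apply: pos => //; apply: lt_le_trans yz.
  by apply: lt_le_trans (ylt i _); [apply: ydec|apply: ltnW].
have ivt : p.[y 1%N] < 0 -> exists z q, [/\ y 1%N <= z <= y 0%N,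
    p = q * ('X - z%:P) & forall i, (i <= d)%N -> 0 <= (-1) ^+ i * q.[y i.+1]].
  move=> p1'; have [|z /andP[z1 z2] rz] := @poly_ivt R p (y 1%N) (y 0%N) (ltW y10).
    by rewrite p1.
  have /factor_theorem[q pE] := rz.
  exists z, q; split=> //; first by rewrite z1 z2.
  apply: (signs z) => //; right; rewrite lt_neqAle z1 andbT.
  by apply/eqP => yz; move: rz; rewrite -yz /root lt_eqF.
move: p1; rewrite le_eqVlt => /orP[/eqP p10|]; last exact: ivt.
have /rootP/factor_theorem[q pE] := p10.
have [q1|q1] := lerP 0 q.[y 1%N].
  exists (y 1%N), q; split=> //; first by rewrite lexx ltW.
  by apply: (signs (y 1%N)) => //; left.
have q0 : 0 <= q.[y 0%N].
  by move: p0; rewrite pE hornerM hornerXsubC pmulr_lge0 // subr_gt0.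
have [|z /andP[z1 z2] rz] := @poly_ivt R q (y 1%N) (y 0%N) (ltW y10).
  by rewrite (ltW q1).
have rzp : root p z by rewrite pE rootM rz.
have /factor_theorem[q' pE'] := rzp.
exists z, q'; split=> //; first by rewrite z1 z2.
apply: (signs z) => //; right; rewrite lt_neqAle z1 andbT.
by apply/eqP => yz; move: rz; rewrite -yz /root lt_eqF.
Qed.

(** * Counting roots by parity *)

Definition count_oo (R : realType) (s : seq R) (y : R) : nat :=
  count (fun r => 0 < r < y) s.

Definition count_oc (R : realType) (s : seq R) (y : R) : nat :=
  count (fun r => 0 < r <= y) s.

Lemma count_oc_oo (R : realType) (s : seq R) (y : R) : 0 < y ->
  count_oc s y = (count_oo s y + count_mem y s)%N.
Proof.
move=> y0; rewrite /count_oc /count_oo; elim: s => //= r s ->.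
rewrite le_eqVlt; case: (eqVneq r y) => [->|ry] /=.
  by rewrite y0 ltxx andbF /= add0n addnCA.
by rewrite add0n addnA.
Qed.

Lemma count_oo_le_oc (R : realType) (s : seq R) (y : R) :
  (count_oo s y <= count_oc s y)%N.
Proof. by apply: sub_count => r /= /andP[-> /ltW ->]. Qed.

Lemma count_oc_le_oo (R : realType) (s : seq R) (y z : R) : y < z ->
  (count_oc s y <= count_oo s z)%N.
Proof.
by move=> yz; apply: sub_count => r /= /andP[-> ry] /=; apply: le_lt_trans yz.
Qed.

(** Each root contributes the factor [(y - r) * (0 - r)], which is negative exactly when [r] lies
    strictly between 0 and [y]. *)
Lemma sign_count_oo (R : realType) (s : seq R) (y : R) : 0 <= y ->
  0 \notin s -> y \notin s ->
  0 < (-1) ^+ count_oo s y *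
    ((\prod_(r <- s) (y - r)) * \prod_(r <- s) (0 - r)).
Proof.
move=> y0; rewrite /count_oo; elim: s => [|r s IH] /=.
  by rewrite !big_nil expr0 !mulr1.
rewrite !inE !negb_or => /andP[r0 s0] /andP[ry sy].
have := IH s0 sy; set c := count _ s; rewrite !big_cons.
set p := \prod_(_ <- _) _; set q := \prod_(_ <- _) _ => h.
have -> : (-1) ^+ ((0 < r < y)%R + c) * ((y - r) * p * ((0 - r) * q)) =
  ((-1) ^+ (0 < r < y)%R * ((y - r) * (0 - r))) * ((-1) ^+ c * (p * q)).
  by rewrite exprD; ring.
rewrite pmulr_lgt0 //; case: (boolP (0 < r < y)) => [/andP[r_gt0 ry0]|].
  by rewrite expr1; nra.
rewrite negb_and -!leNgt expr0 mul1r => h3.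
by move: r0 ry; rewrite !neq_lt => /orP[] h1 /orP[] h2; case/orP: h3 => h3; nra.
Qed.

(** Since the value at 0 is positive, the sign at [y] decides the parity. In the product of the two
    values only the square of [C] occurs, so its sign drops out. *)
Lemma parity_count_oo (R : realType) (C : R) (s : seq R) (y : R) (j : nat) :
  0 <= y -> 0 \notin s -> y \notin s ->
  0 < C * \prod_(r <- s) (0 - r) ->
  0 <= (-1) ^+ j * (C * \prod_(r <- s) (y - r)) ->
  odd (count_oo s y) = odd j.
Proof.
move=> y0 s0 sy; have := sign_count_oo y0 s0 sy.
rewrite -signr_odd -[(-1) ^+ j]signr_odd.
set p := \prod_(_ <- _) _; set q := \prod_(_ <- _) _ => h1 h2 h3.
have : 0 <= (-1) ^+ odd j * (C * p) * (C * q) by rewrite mulr_ge0 // ltW.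
have -> : (-1) ^+ odd j * (C * p) * (C * q) =
    (-1) ^+ odd j * (p * q) * C ^+ 2 by ring.
have C2 : 0 < C ^+ 2.
  rewrite lt_neqAle sqr_ge0 andbT eq_sym expf_eq0 /=.
  by apply/eqP => C0; rewrite C0 mul0r ltxx in h2.
rewrite pmulr_lge0 // => {}h3; move: h1 h3.
by case: (odd _); case: (odd _) => //=; rewrite ?expr0 ?expr1; lra.
Qed.

(* [N j] and [M j] stand for the numbers of roots below the [j]-th point, the
   point itself excluded and included; [tie j] says that the points [j] and
   [j + 1] coincide. *)
Lemma alternating_chain (K : nat) (N M : nat -> nat) (tie : pred nat) :
  (forall j, (j < K)%N -> exists m, [/\ odd m = odd j, (N j <= m <= M j)%N &
     (j.+1 < K)%N -> tie j -> (m < M j)%N]) ->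
  (forall j, (j.+1 < K)%N -> ~~ tie j -> (M j <= N j.+1)%N) ->
  (forall j, (j.+1 < K)%N -> tie j ->
     [/\ N j.+1 = N j, M j.+1 = M j & (j.+2 < K)%N -> ~~ tie j.+1]) ->
  forall j n r, (j + n < K)%N -> (j + r <= N j)%N ->
    (j + n + r + odd r <= M (j + n))%N.
Proof.
move=> val mono tied j n r jnK rN.
(* The induction carries a witness with the parity of its index. Parity rounds [j + r] up to
   [j + r + odd r] at the start, and its alternation raises the witness by at least one at every
   step. *)
suff : exists m, [/\ odd m = odd (j + n), (j + n + r + odd r <= m)%N,
    (N (j + n) <= m <= M (j + n))%N &
    ((j + n).+1 < K)%N -> tie (j + n)%N -> (m < M (j + n))%N].
  by move=> [m [_ h /andP[_ h'] _]]; apply: leq_trans h'.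
elim: n jnK => [|n IH] jnK.
  rewrite addn0 in jnK *; have [m [m1 m2 m3]] := val j jnK.
  by exists m; split=> //; lia.
rewrite addnS in jnK *; have [m [m1 m2 m3 m4]] := IH (ltnW jnK).
(* At a tie both points share their bounds, and the room left by [m < M (j + n)] admits [m.+1].
   Otherwise monotonicity together with the change of parity separates the two witnesses. *)
case: (boolP (tie (j + n)%N)) => [t|t].
  have [e1 e2 e3] := tied _ jnK t; have := m4 jnK t => h.
  exists m.+1; split; rewrite ?e1 ?e2; first by rewrite /= m1.
  - lia.
  - lia.
  - by move=> h'; rewrite (negbTE (e3 h')).
have := mono _ jnK t => h; have [m' [m1' m2' m3']] := val _ jnK.
by exists m'; split=> //; move: m1' => /=; lia.
Qed.

(** * Caustics against the positive Jacobi coordinates *)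

Definition pole_prod (R : realType) (I : finType) (a ep : I -> R) (mu : R) : R :=
  \prod_i (a i - ep i * mu).

(** The numerator of [sum_i u_i / (a_i - ep_i mu)] over the common denominator [pole_prod], which
    keeps a meaning at the poles. The signs [ep] are left abstract so that they can be reversed. *)
Definition pole_sum (R : realType) (I : finType) (a ep u : I -> R) (mu : R) : R :=
  \sum_i u i * \prod_(j | j != i) (a j - ep j * mu).

Section PolePolynomials.
Variables (R : realType) (I : finType) (a ep : I -> R).

Definition pole_factor i : {poly R} := (a i)%:P - ep i *: 'X.

Definition pole_sum_poly (u : I -> R) : {poly R} :=
  \sum_i u i *: \prod_(j | j != i) pole_factor j.

Lemma horner_pole_factor i mu : (pole_factor i).[mu] = a i - ep i * mu.
Proof. by rewrite !hornerE. Qed.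

Lemma horner_pole_prod mu : (\prod_i pole_factor i).[mu] = pole_prod a ep mu.
Proof. by rewrite horner_prod; apply: eq_bigr => i _; rewrite horner_pole_factor. Qed.

Lemma horner_pole_sum u mu : (pole_sum_poly u).[mu] = pole_sum a ep u mu.
Proof.
rewrite horner_sum; apply: eq_bigr => i _; rewrite hornerZ horner_prod.
by congr (_ * _); apply: eq_bigr => j _; rewrite horner_pole_factor.
Qed.

Lemma pole_sum_at_pole u i mu : a i - ep i * mu = 0 ->
  pole_sum a ep u mu = u i * \prod_(j | j != i) (a j - ep j * mu).
Proof.
move=> h; rewrite /pole_sum (bigD1 i) //= [X in _ + X]big1 ?addr0 // => j ji.
by rewrite (bigD1 i) 1?eq_sym //= h mul0r mulr0.
Qed.

Lemma pole_prod_at_pole i mu : a i - ep i * mu = 0 -> pole_prod a ep mu = 0.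
Proof. by move=> h; rewrite /pole_prod (bigD1 i) //= h mul0r. Qed.

End PolePolynomials.

(** With [N] roots before a point and [n] at the point, counting none or one of the latter already
    realises either parity. *)
Lemma parity_between (j N n : nat) : (0 < n)%N ->
  exists m, [/\ odd m = odd j, (N <= m <= N + n)%N & (1 < n)%N -> (m < N + n)%N].
Proof.
move=> n0; case: (boolP (odd N == odd j)) => [/eqP h|h].
  by exists N; split=> //; lia.
by exists N.+1; split=> //; lia.
Qed.

(** * Sign of the tangency polynomial at the coordinates of one sign *)

Section Half.
Variables (R : realType) (I : finType) (a ep x v Lam : I -> R).
Variables (C : R) (s : seq R) (K : nat) (g : nat -> I).
Hypothesis ep_sign : forall i, ep i = 1 \/ ep i = -1.
Hypothesis a_gt0 : forall i, 0 < a i.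
Hypothesis jacobiE : forall mu,
  pole_prod a ep mu - pole_sum a ep (fun i => x i ^+ 2) mu =
  \prod_i (ep i * (Lam i - mu)).
Hypothesis tangencyE : forall mu,
  C * \prod_(r <- s) (mu - r) * pole_prod a ep mu =
  pole_sum a ep (fun i => x i * v i) mu ^+ 2 +
  pole_sum a ep (fun i => v i ^+ 2) mu *
    (pole_prod a ep mu - pole_sum a ep (fun i => x i ^+ 2) mu).
Hypothesis P0_gt0 : 0 < C * \prod_(r <- s) (0 - r).
Hypothesis g_pos : forall j, (j < K)%N -> ep (g j) = 1.
Hypothesis g_surj : forall i, ep i = 1 -> exists2 j, (j < K)%N & i = g j.
Hypothesis g_incr : forall i j, (i < j < K)%N -> a (g i) < a (g j).
Hypothesis Lam_ge0 : forall j, (j < K)%N -> 0 <= Lam (g j).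
Hypothesis Lam_le : forall j, (j < K)%N -> Lam (g j) <= a (g j).
Hypothesis Lam_ge : forall i j, (i < j < K)%N -> a (g i) <= Lam (g j).
Hypothesis Lam_le0 : forall i, ep i = -1 -> Lam i <= 0.

Let P : {poly R} := C *: \prod_(r <- s) ('X - r%:P).

Let hornerP mu : P.[mu] = C * \prod_(r <- s) (mu - r).
Proof.
rewrite hornerZ horner_prod; congr (_ * _).
by apply: eq_bigr => r _; rewrite hornerXsubC.
Qed.

Let PPi := \prod_i pole_factor a ep i.
Let W := pole_sum_poly a ep (fun i => x i * v i).
Let V := pole_sum_poly a ep (fun i => v i ^+ 2).
Let J := \prod_i (ep i *: ((Lam i)%:P - 'X)).

Let horner_root i mu : (ep i *: ((Lam i)%:P - 'X)).[mu] = ep i * (Lam i - mu).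
Proof. by rewrite !hornerE. Qed.

Let hornerJ mu : J.[mu] = \prod_i (ep i * (Lam i - mu)).
Proof. by rewrite horner_prod; apply: eq_bigr => i _; rewrite horner_root. Qed.

Let tangency_polyE : P * PPi = W ^+ 2 + V * J.
Proof.
apply: poly_ext => mu; rewrite hornerM hornerP horner_pole_prod tangencyE.
by rewrite jacobiE !expr2 hornerD !hornerM !horner_pole_sum hornerJ.
Qed.

Let g_inj i j : (i < K)%N -> (j < K)%N -> g i = g j -> i = j.
Proof.
move=> iK jK gij; case: (ltngtP i j) => // h.
  by have := @g_incr i j; rewrite gij ltxx h jK => /(_ isT).
by have := @g_incr j i; rewrite gij ltxx h iK => /(_ isT).
Qed.

Let nonpole_factor i mu : 0 <= mu -> a i - ep i * mu = 0 ->
  ep i = 1 /\ a i = mu.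
Proof.
move=> mu0; have := a_gt0 i; case: (ep_sign i) => ->.
  by rewrite mul1r => _ /eqP; rewrite subr_eq0 => /eqP.
by rewrite mulN1r; lra.
Qed.

Let pole_factorE i mu : a i - ep i * mu = ep i * (ep i * a i - mu).
Proof. by case: (ep_sign i) => ->; ring. Qed.

(** Exactly [j] indices of positive sign precede [g j], and [(-1) ^+ j] is shared out among their
    nonpositive factors. *)
Let sign_prod_but j (T : I -> R) : (j < K)%N ->
  (forall i, ep i = -1 -> 0 <= T i) ->
  (forall m, (m < j)%N -> T (g m) <= 0) ->
  (forall m, (j < m < K)%N -> 0 <= T (g m)) ->
  0 <= (-1) ^+ j * \prod_(i | i != g j) T i.
Proof.
move=> jK hneg hlow hhigh.
pose A := [set g (nat_of_ord m) | m in 'I_j]%SET.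
have cardA : #|A| = j.
  rewrite card_imset ?card_ord // => m m' /g_inj h.
  by apply/val_inj/h; apply: ltn_trans jK.
have gjA i : i \in A -> i != g j.
  move=> /imsetP[m _ ->]; apply/eqP => /g_inj h.
  by have := ltn_ord m; rewrite h ?ltnn //; apply: ltn_trans jK.
have -> : (-1) ^+ j = \prod_(i | i != g j) (if i \in A then -1 else 1) :> R.
  rewrite -[in LHS]cardA -big_mkcondr /=.
  rewrite -prodr_const; apply: eq_bigl => i.
  by case: (boolP (i \in A)) => [/gjA ->|]; rewrite ?andbF.
rewrite -big_split /=; apply: prodr_ge0 => i ij.
case: ifP => [/imsetP[m _ ->]|iA]; first by rewrite mulN1r oppr_ge0 hlow.
rewrite mul1r; case: (ep_sign i) => [/g_surj[m mK ig]|]; last exact: hneg.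
rewrite ig hhigh // mK andbT; case: (ltngtP m j) => // h; last by rewrite ig h eqxx in ij.
by move: iA; rewrite ig => /negP[]; apply/imsetP; exists (Ordinal h).
Qed.

(** At a nonnegative [y] only factors of positive sign can vanish, and their poles are pairwise
    distinct. *)
Let others_neq0 m y : 0 <= y -> a m - ep m * y = 0 ->
  \prod_(i | i != m) (a i - ep i * y) != 0.
Proof.
move=> y0 hm; have [em am] := nonpole_factor y0 hm.
apply/prodf_neq0 => i im; apply/eqP => /(nonpole_factor y0)[ei ai].
have [p pK ip] := g_surj ei; have [q qK mq] := g_surj em.
move/eqP: im; apply; rewrite ip mq; congr g; case: (ltngtP p q) => // h.
  by have := @g_incr p q; rewrite -ip -mq ai am ltxx h qK => /(_ isT).
by have := @g_incr q p; rewrite -ip -mq ai am ltxx h pK => /(_ isT).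
Qed.

(** At the pole of [m] the Jacobi polynomial reduces to [- x m ^+ 2] times a nonzero product. *)
Let coord_eq0 m y : 0 <= y -> a m - ep m * y = 0 -> J.[y] = 0 -> x m = 0.
Proof.
move=> y0 hm Jy; have := jacobiE y; rewrite -hornerJ Jy (pole_prod_at_pole hm).
rewrite (pole_sum_at_pole _ hm) sub0r => /eqP; rewrite oppr_eq0 mulf_eq0.
by rewrite (negPf (others_neq0 y0 hm)) orbF expf_eq0 /= => /eqP.
Qed.

Let sign_at_root j : (j < K)%N -> 0 <= (-1) ^+ j * P.[Lam (g j)].
Proof.
move=> jK; set y := Lam (g j); have y0 : 0 <= y := Lam_ge0 jK.
have Jy : J.[y] = 0.
  by rewrite hornerJ (bigD1 (g j)) //= subrr mulr0 mul0r.
have [[m hm]|reg] := pselect (exists m, a m - ep m * y = 0); last first.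
  (* Away from the poles, [J.[y] = 0] turns [P * PPi] into the square of [W] at [y], so [P] has
     weakly the sign of the pole product there. *)
  have sPi : 0 < (-1) ^+ j * pole_prod a ep y.
    rewrite lt_neqAle eq_sym mulf_neq0 ?signr_eq0 //=; last first.
      apply/prodf_neq0 => i _; apply/eqP => h; apply: reg; by exists i.
    rewrite /pole_prod (bigD1 (g j)) //= g_pos // mul1r.
    have aj : 0 <= a (g j) - y by rewrite subr_ge0 Lam_le.
    rewrite mulrCA mulr_ge0 //; apply: sign_prod_but => // [i|m mj|m /andP[jm mK]].
    - by move=> ->; have := a_gt0 i; lra.
    - have := @Lam_ge m j; rewrite mj jK g_pos; last exact: ltn_trans jK.
      by move=> /(_ isT); rewrite -/y; lra.
    - have := @g_incr j m; rewrite jm mK g_pos // => /(_ isT).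
      by have := Lam_le jK; rewrite -/y; lra.
  have := congr1 (fun p => p.[y]) tangency_polyE.
  rewrite expr2 hornerD !hornerM Jy mulr0 addr0 horner_pole_prod -expr2 => h.
  rewrite -(pmulr_lge0 _ sPi) mulrACA -expr2 sqrr_sign mul1r h; exact: sqr_ge0.
(* At a pole, [x m = 0] makes [W], [PPi] and [J] all divisible by ['X - y]. After one cancellation
   the square of [W1] still carries a factor vanishing at [y], which leaves [v m ^+ 2 * J'.[y]] as
   the value of [P]. *)
have [em am] := nonpole_factor y0 hm.
have Pi1 := others_neq0 y0 hm.
have xm := coord_eq0 y0 hm Jy.
have /factor_theorem[W1 WE] : root W y.
  by rewrite /root horner_pole_sum (pole_sum_at_pole _ hm) xm !mul0r.
pose Pi' := \prod_(i | i != m) pole_factor a ep i.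
pose J' := \prod_(i | i != g j) (ep i *: ((Lam i)%:P - 'X)).
have PiE : PPi = - ('X - y%:P) * Pi'.
  by rewrite /PPi (bigD1 m) //= /pole_factor em am scale1r opprB.
have JE : J = - ('X - y%:P) * J'.
  by rewrite /J (bigD1 (g j)) //= g_pos // scale1r opprB.
have key : P * Pi' = - ('X - y%:P) * W1 ^+ 2 + V * J'.
  apply: (@mulfI _ (- ('X - y%:P))); first by rewrite oppr_eq0 polyXsubC_eq0.
  by rewrite mulrCA -PiE tangency_polyE WE JE; ring.
have Pi'y : Pi'.[y] = \prod_(i | i != m) (a i - ep i * y).
  by rewrite horner_prod; apply: eq_bigr => i _; rewrite horner_pole_factor.
have Vy : V.[y] = v m ^+ 2 * Pi'.[y].
  by rewrite horner_pole_sum (pole_sum_at_pole _ hm) Pi'y.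
have -> : P.[y] = v m ^+ 2 * J'.[y].
  have := congr1 (fun p => p.[y]) key; rewrite hornerD !hornerM hornerN hornerXsubC.
  rewrite subrr oppr0 mul0r add0r Vy => h; apply: (mulIf Pi1).
  by rewrite -Pi'y h; ring.
rewrite mulrCA mulr_ge0 ?sqr_ge0 // horner_prod.
apply: sign_prod_but => // [i ei|p pj|p /andP[jp pK]]; rewrite horner_root.
- by have := Lam_le0 ei; rewrite ei; lra.
- have pK : (p < K)%N by apply: ltn_trans jK.
  by have := @Lam_ge p j; have := Lam_le pK; rewrite g_pos // pj jK /y => h /(_ isT); lra.
- by have := @Lam_ge j p; have := Lam_le jK; rewrite g_pos // jp pK /y => h /(_ isT); lra.
Qed.

(** By interlacing, two coordinates can meet only at the pole [a (g j)]. There [J] has a double and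
    [PPi] a simple zero, so that [P] vanishes as well; the sign of the quotient of [P] by its linear
    factor replaces the lost sign of [P]. *)
Let sign_at_double_root j : (j.+1 < K)%N -> Lam (g j) = Lam (g j.+1) ->
  [/\ 0 < Lam (g j), P.[Lam (g j)] = 0 &
    forall P1, P = P1 * ('X - (Lam (g j))%:P) ->
      0 <= (-1) ^+ j * - P1.[Lam (g j)]].
Proof.
move=> jK' LL; have jK := ltnW jK'; have := g_pos jK; have := g_pos jK'.
have yE : Lam (g j) = a (g j).
  apply/eqP; rewrite eq_le Lam_le // LL; apply: Lam_ge; by rewrite ltnSn.
set i := g j in LL yE *; set i' := g j.+1 in LL * => ei' ei.
set y := Lam i; have y_gt0 : 0 < y by rewrite /y yE.
have y0 := ltW y_gt0.
have i'i : i' != i by apply/eqP => /g_inj h; have := h jK' jK; lia.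
have Jy : J.[y] = 0 by rewrite hornerJ (bigD1 i) //= subrr mulr0 mul0r.
have hi : a i - ep i * y = 0 by rewrite ei mul1r /y yE subrr.
have Pi1 := others_neq0 y0 hi.
have xi := coord_eq0 y0 hi Jy.
have /factor_theorem[W1 WE] : root W y.
  by rewrite /root horner_pole_sum (pole_sum_at_pole _ hi) xi !mul0r.
pose Pi' := \prod_(n | n != i) pole_factor a ep n.
pose J' := \prod_(n | (n != i) && (n != i')) (ep n *: ((Lam n)%:P - 'X)).
have PiE : PPi = - ('X - y%:P) * Pi'.
  by rewrite /PPi (bigD1 i) //= /pole_factor ei -yE scale1r opprB.
have JE : J = ('X - y%:P) ^+ 2 * J'.
  rewrite /J (bigD1 i) //= (bigD1 i') //= ei ei' -LL !scale1r -/y mulrA.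
  by congr (_ * _); ring.
have Xy0 : 'X - y%:P != 0 by rewrite polyXsubC_eq0.
have key : P * Pi' = - ('X - y%:P) * (W1 ^+ 2 + V * J').
  apply: (@mulfI _ (- ('X - y%:P))); first by rewrite oppr_eq0.
  by rewrite mulrCA -PiE tangency_polyE WE JE; ring.
have Pi'y : Pi'.[y] = \prod_(n | n != i) (a n - ep n * y).
  by rewrite horner_prod; apply: eq_bigr => n _; rewrite horner_pole_factor.
have Vy : V.[y] = v i ^+ 2 * Pi'.[y].
  by rewrite horner_pole_sum (pole_sum_at_pole _ hi) Pi'y.
split=> // [|P1 PE].
  have := congr1 (fun p => p.[y]) key; rewrite !hornerM hornerN hornerXsubC.
  rewrite subrr oppr0 mul0r Pi'y => /eqP; rewrite mulf_eq0 (negPf Pi1) orbF.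
  by move/eqP.
have key1 : - P1 * Pi' = W1 ^+ 2 + V * J'.
  by apply: (mulfI Xy0); apply: oppr_inj; rewrite -[RHS]mulNr -key PE; ring.
have sPi : 0 < (-1) ^+ j * Pi'.[y].
  rewrite lt_neqAle eq_sym mulf_neq0 ?signr_eq0 ?Pi'y //=.
  apply: sign_prod_but => // [n ->|m mj|m /andP[jm mK]].
  - by have := a_gt0 n; lra.
  - have := @g_incr m j; rewrite mj jK g_pos; last exact: ltn_trans jK.
    by move=> /(_ isT); rewrite -/i -yE -/y; lra.
  - have := @g_incr j m; rewrite jm mK g_pos // => /(_ isT).
    by rewrite -/i -yE -/y; lra.
rewrite -(pmulr_lge0 _ sPi) mulrACA -expr2 sqrr_sign mul1r -hornerN -hornerM.
rewrite key1 expr2 hornerD !hornerM -expr2 addr_ge0 ?sqr_ge0 //.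
rewrite Vy -mulrA mulr_ge0 ?sqr_ge0 // Pi'y (bigD1 i') //= -mulrA.
rewrite ei' mul1r mulr_ge0 //.
  by rewrite subr_ge0 /y LL Lam_le.
(* Each remaining coordinate lies weakly on the same side of [y] as its own pole, so the paired
   factors are nonnegative. *)
rewrite horner_prod -big_split /=; apply: prodr_ge0 => n /andP[ni ni'].
rewrite horner_root pole_factorE.
have -> : ep n * (ep n * a n - y) * (ep n * (Lam n - y)) =
    (ep n * a n - y) * (Lam n - y).
  by case: (ep_sign n) => ->; ring.
case: (ep_sign n) => en.
  have [p pK np] := g_surj en; rewrite en mul1r.
  have [pj|jp|pj] := ltngtP p j; last by move: ni; rewrite np pj eqxx.
    have := @g_incr p j; rewrite pj jK => /(_ isT); rewrite -np -/i -yE -/y.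
    have := Lam_le pK; rewrite -np; nra.
  have h : (j.+1 < p)%N.
    rewrite ltn_neqAle jp andbT; apply/eqP => h.
    by move: ni'; rewrite np -h eqxx.
  have := @Lam_ge j.+1 p; have := Lam_le pK; rewrite h pK -np => h1 /(_ isT) h2.
  have := Lam_le jK'; rewrite -/i' -LL -/y => h3.
  by rewrite mulr_ge0 // subr_ge0; lra.
have := Lam_le0 en; have := a_gt0 n; rewrite en; nra.
Qed.

Let s0 : 0 \notin s.
Proof.
apply/negP => h; move: P0_gt0; rewrite (big_rem 0) //= subrr mul0r mulr0.
by rewrite ltxx.
Qed.

(** The witnesses for the parity chain. If [y] is not a root of [P], the sign of [P] gives the
    parity; if it is one, the multiplicity leaves a choice, except for a simple root at a tie. *)
Let valid j : (j < K)%N -> exists m, [/\ odd m = odd j,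
  (count_oo s (Lam (g j)) <= m <= count_oc s (Lam (g j)))%N &
  (j.+1 < K)%N -> Lam (g j) == Lam (g j.+1) ->
    (m < count_oc s (Lam (g j)))%N].
Proof.
move=> jK; set y := Lam (g j); have y0 : 0 <= y := Lam_ge0 jK.
have [tie|notie] := boolP ((j.+1 < K)%N && (y == Lam (g j.+1))).
  have /andP[jK' /eqP LL] := tie.
  have [y_gt0 Py hP1] := sign_at_double_root jK' LL; rewrite -/y in y_gt0 Py hP1.
  have C0 : C != 0 by apply/eqP => C0; move: P0_gt0; rewrite C0 mul0r ltxx.
  have ys : y \in s.
    move: Py; rewrite hornerP => /eqP; rewrite mulf_eq0 (negPf C0) /=.
    by rewrite prodf_seq_eq0 => /hasP[r rs]; rewrite subr_eq0 => /eqP ->.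
  rewrite count_oc_oo //; have permE := perm_to_rem ys.
  have cm : count_mem y s = (count_mem y (rem y s)).+1.
    by rewrite (permP permE) /= eqxx.
  have [ys1|ys1] := boolP (y \in rem y s).
    have : (0 < count_mem y (rem y s))%N by rewrite -has_count has_pred1.
    rewrite -ltnS -cm => c1.
    have [m [m1 m2 m3]] := parity_between j (count_oo s y) (ltnW c1).
    by exists m; split=> // _ _; apply: m3.
  (* Removing the simple root [y] does not affect the strict count. The removed factor [0 - y] is
     negative, so the quotient is taken with leading coefficient [- C] to be positive at 0. *)
  have par : odd (count_oo s y) = odd j.
    have -> : count_oo s y = count_oo (rem y s) y.
      by rewrite /count_oo (permP permE) /= ltxx andbF.
    apply: (@parity_count_oo _ (- C)) => //.
    - by apply: contra s0 => /mem_rem.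
    - move: P0_gt0; rewrite (perm_big _ permE) big_cons /= sub0r.
      set q := \prod_(_ <- rem _ _) _.
      have -> : C * (- y * q) = y * (- C * q) by ring.
      by rewrite pmulr_rgt0.
    - have := hP1 (C *: \prod_(r <- rem y s) ('X - r%:P)).
      rewrite /P (perm_big _ permE) big_cons /= -scalerAl mulrC => /(_ erefl).
      rewrite hornerZ horner_prod mulNr.
      by under eq_bigr do rewrite hornerXsubC.
  by exists (count_oo s y); rewrite leqnn leq_addr cm addnS ltnS leq_addr.
have noext m : (j.+1 < K)%N -> y == Lam (g j.+1) -> (m < count_oc s y)%N.
  by move=> h1 h2; rewrite h1 h2 in notie.
have [ys|ys] := boolP (y \in s); last first.
  exists (count_oo s y); rewrite leqnn count_oo_le_oc; split=> //; last exact: noext.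
  apply: (@parity_count_oo _ C) => //.
  by rewrite -hornerP; exact: sign_at_root.
have y_gt0 : 0 < y.
  have [yz|] := eqVneq y 0; first by move: ys; rewrite yz (negPf s0).
  by rewrite lt_neqAle y0 andbT eq_sym.
have : (0 < count_mem y s)%N by rewrite -has_count has_pred1.
move=> /(parity_between j (count_oo s y)); rewrite -count_oc_oo //.
by move=> [m [m1 m2 _]]; exists m; split=> //; exact: noext.
Qed.

Let chain j n r : (j + n < K)%N -> (j + r <= count_oo s (Lam (g j)))%N ->
  (j + n + r + odd r <= count_oc s (Lam (g (j + n)%N)))%N.
Proof.
move=> h1 h2; refine (alternating_chain (K := K)
  (N := fun j => count_oo s (Lam (g j))) (M := fun j => count_oc s (Lam (g j)))
  (tie := fun j => Lam (g j) == Lam (g j.+1)) valid _ _ h1 h2).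
- move=> i iK nt; apply: count_oc_le_oo; rewrite lt_neqAle nt /=.
  have := @Lam_ge i i.+1; rewrite ltnSn iK => /(_ isT).
  by apply: le_trans; apply: Lam_le; exact: ltnW.
- move=> i iK /eqP LL; rewrite -LL; split=> // iK2; apply/eqP => e.
  have := @Lam_ge i.+1 i.+2; rewrite ltnSn iK2 -e => /(_ isT) h3.
  have := @g_incr i i.+1; rewrite ltnSn iK => /(_ isT).
  by have := @Lam_le _ (ltnW iK); lra.
Qed.

Let total := count (fun r => 0 < r) s.

Let count_oc_total y : (count_oc s y <= total)%N.
Proof. by apply: sub_count => r /= /andP[]. Qed.

(** The chain started at index 0 without excess arrives at the top coordinate with at least [K - 1]
    positive caustics. *)
Lemma half_count_total : (K <= total.+1)%N.
Proof.
case: (posnP K) => [->//|K0].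
have := @chain 0 K.-1 0; rewrite !add0n prednK // !addn0 => /(_ (leqnn _) isT) h.
by rewrite -(prednK K0) ltnS (leq_trans h) ?count_oc_total.
Qed.

Lemma half_count_oc j : (j < K)%N -> (j <= count_oc s (Lam (g j)))%N.
Proof. by move=> jK; have := @chain 0 j 0 jK isT; rewrite add0n !addn0. Qed.

(** An excess of one below the [j]-th coordinate is rounded up by parity to an excess of two, so the
    chain would end with [K + 1] positive caustics. *)
Lemma half_count_oo j : (total <= K)%N -> (j < K)%N ->
  (count_oo s (Lam (g j)) <= j)%N.
Proof.
move=> tK jK; rewrite leqNgt; apply/negP => h.
have jE : (j + (K.-1 - j) = K.-1)%N by lia.
have := @chain j (K.-1 - j) 1; rewrite jE addn1 => /(_ _ h) /=.
have := count_oc_total (Lam (g K.-1)).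
move: (count_oc _ _) => n nt /(_ _); lia.
Qed.

End Half.

(** * Jacobi coordinates of a point *)

Lemma eps_sign (R : realType) (k l : nat) (i : 'I_(k + l)) :
  eps R i = 1 \/ eps R i = -1.
Proof. by rewrite /eps; case: ifP; [left|right]. Qed.

Lemma eps_sqr (R : realType) (k l : nat) (i : 'I_(k + l)) : eps R i * eps R i = 1.
Proof. by case: (eps_sign R i) => ->; rewrite ?mulrNN mulr1. Qed.

Lemma eps_eq1 (R : realType) (k l : nat) (i : 'I_(k + l)) :
  (eps R i = 1) <-> (i < k)%N.
Proof.
rewrite /eps; case: ifP => _ //=; split=> // h.
by exfalso; lra.
Qed.

Lemma eps_eqN1 (R : realType) (k l : nat) (i : 'I_(k + l)) :
  (eps R i = -1) <-> (k <= i)%N.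
Proof.
rewrite /eps [(k <= i)%N]leqNgt; case: ifP => _ //=; split=> // h.
by exfalso; lra.
Qed.

Lemma prod_nat_range (R : comRingType) (n u w : nat) (c : R) :
  (u <= w <= n)%N ->
  \prod_(j < n) (if (u <= j < w)%N then c else 1) = c ^+ (w - u).
Proof.
move=> /andP[uw wn].
rewrite -(big_mkord xpredT (fun j => if (u <= j < w)%N then c else 1)).
rewrite (@big_cat_nat _ _ _ u) //=; last exact: leq_trans wn.
rewrite (@big_cat_nat _ _ _ w u) //= big_nat_cond big1 ?mul1r; last first.
  by move=> j /andP[/andP[_ ju] _]; rewrite leqNgt ju.
rewrite [X in _ * X]big_nat_cond [X in _ * X]big1 ?mulr1; last first.
  by move=> j /andP[/andP[wj _] _]; rewrite (ltnNge j) wj andbF.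
rewrite big_nat_cond (eq_bigr (fun=> c)); last by move=> j /andP[-> _].
by rewrite -big_nat_cond prodr_const_nat.
Qed.

Section Ellipsoid.
Variables (R : realType) (k l : nat) (a : 'I_(k + l) -> R).
Hypothesis hk : (1 <= k)%N.
Hypothesis a_gt0 : forall i, 0 < a i.
Hypothesis a_decr : forall i j : 'I_(k + l), (i < j)%N ->
  eps R j * a j < eps R i * a i.

Local Notation ep := (@eps R k l).
Local Notation E i := (eps R i * a i).

(** The normalisation comes from the leading coefficient: [pole_prod] itself is the product of the
    [eps R i * (E i - mu)]. *)
Definition jacobi_factors (x : 'rV[R]_(k + l)) (L : 'I_(k + l) -> R) :=
  forall mu, pole_prod a ep mu - pole_sum a ep (fun i => x 0 i ^+ 2) mu =
    \prod_i (eps R i * (L i - mu)).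

(** The [i]-th closed gap runs from the pole [E i] towards 0 and stops at the next pole of the same
    sign, or at 0 if there is none; [open_gap] is its interior. *)
Definition interlaced (L : 'I_(k + l) -> R) := forall i,
  0 <= eps R i * L i <= a i /\
  forall m, eps R m = eps R i -> a m < a i -> a m <= eps R i * L i.

Definition open_gap (i : 'I_(k + l)) (mu : R) :=
  0 < eps R i * mu < a i /\
  forall m, eps R m = eps R i -> a m < a i -> a m < eps R i * mu.

Lemma jacobi_polyE x :
  jacobi_poly a x = \prod_i pole_factor a ep i -
                    pole_sum_poly a ep (fun i => x 0 i ^+ 2).
Proof. by []. Qed.

Lemma horner_jacobi x mu : (jacobi_poly a x).[mu] =
  pole_prod a ep mu - pole_sum a ep (fun i => x 0 i ^+ 2) mu.
Proof.
by rewrite jacobi_polyE hornerD hornerN horner_pole_prod horner_pole_sum.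
Qed.

Lemma size_pole_factor i : size (pole_factor a ep i) = 2%N.
Proof.
have -> : pole_factor a ep i = - eps R i *: ('X - (E i)%:P).
  apply: poly_ext => mu; rewrite horner_pole_factor !hornerE.
  by case: (eps_sign R i) => ->; ring.
rewrite size_scale ?size_XsubC // oppr_eq0.
by case: (eps_sign R i) => ->; rewrite ?oppr_eq0 oner_neq0.
Qed.

Lemma lead_pole_factor i : lead_coef (pole_factor a ep i) = - eps R i.
Proof.
rewrite lead_coefE size_pole_factor /= coefB coefC coefZ coefX /=.
by rewrite mulr1 sub0r.
Qed.

Lemma pole_factor_neq0 i : pole_factor a ep i != 0.
Proof. by rewrite -size_poly_gt0 size_pole_factor. Qed.

Lemma size_pole_prod (Q : pred 'I_(k + l)) :
  size (\prod_(i | Q i) pole_factor a ep i) = #|Q|.+1.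
Proof.
rewrite size_prod; last by move=> i _; exact: pole_factor_neq0.
rewrite (eq_bigr (fun=> 2%N)) ?sum_nat_const; last first.
  by move=> i _; exact: size_pole_factor.
by rewrite muln2 -addnn -addSn addnK.
Qed.

Lemma size_lead_jacobi x : size (jacobi_poly a x) = (k + l).+1 /\
  lead_coef (jacobi_poly a x) = \prod_i (- ep i).
Proof.
have szPi : size (\prod_i pole_factor a ep i) = (k + l).+1.
  by rewrite size_pole_prod card_ord.
have szS : (size (- pole_sum_poly a ep (fun i => (x 0 i ^+ 2)%R)) <
            size (\prod_i pole_factor a ep i)%R)%N.
  rewrite szPi size_polyN ltnS; apply: (leq_trans (size_sum _ _ _)).
  apply/bigmax_leqP => i _; apply: (leq_trans (size_scale_leq _ _)).
  rewrite size_pole_prod.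
  have := cardC1 i; rewrite card_ord => ->.
  by rewrite prednK //; apply: leq_ltn_trans (ltn_ord i).
rewrite jacobi_polyE size_polyDl // lead_coefDl // szPi lead_coef_prod.
by split=> //; apply: eq_bigr => i _; exact: lead_pole_factor.
Qed.

Lemma E_antitone (i j : 'I_(k + l)) : (i <= j)%N -> E j <= E i.
Proof.
rewrite leq_eqVlt => /orP[/eqP/val_inj ->//|ij].
by apply/ltW/a_decr.
Qed.

Lemma E_pos (i : 'I_(k + l)) : (i < k)%N -> eps R i = 1 /\ E i = a i.
Proof. by move=> /eps_eq1 ->; rewrite mul1r. Qed.

Lemma E_neg (i : 'I_(k + l)) : (k <= i)%N -> eps R i = -1 /\ E i = - a i.
Proof. by move=> /eps_eqN1 ->; rewrite mulN1r. Qed.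

Lemma pole_at_E (i : 'I_(k + l)) : a i - eps R i * E i = 0.
Proof. by rewrite mulrA eps_sqr mul1r subrr. Qed.

Lemma pole_factor_diff (i : 'I_(k + l)) mu : a i - eps R i * mu = eps R i * (E i - mu).
Proof. by rewrite mulrBr mulrA eps_sqr mul1r. Qed.

(** Only the summand of the pole [m] survives. The first exponent is the position of [E m] among the
    decreasing nodes, where 0 occupies position [k] and pushes the negative poles up by one. *)
Lemma jacobi_sign_at_pole x (m : 'I_(k + l)) :
  0 <= (-1) ^+ (if (m < k)%N then val m else m.+1) * ((-1) ^+ k * (jacobi_poly a x).[E m]).
Proof.
rewrite horner_jacobi (pole_prod_at_pole (pole_at_E m)).
rewrite (pole_sum_at_pole _ (pole_at_E m)) sub0r.
(* The range from [u] to [w] collects the poles strictly between [E m] and 0, which are those whose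
   factor is negative at [E m]. *)
pose u := if (m < k)%N then m.+1 else k; pose w := if (m < k)%N then k else m : nat.
have uw : (u <= w <= k + l)%N.
  rewrite /u /w; case: ltnP => h; first by rewrite h leq_addr.
  by rewrite h ltnW.
have mN : (u <= m < w)%N = false.
  by rewrite /u /w; case: ltnP => h; rewrite ?ltnn ?andbF.
have -> : (-1) ^+ (if (m < k)%N then val m else m.+1) *
    ((-1) ^+ k * - (x 0 m ^+ 2 * \prod_(j | j != m) (a j - eps R j * E m))) =
    x 0 m ^+ 2 * ((-1) ^+ (w - u) * \prod_(j | j != m) (a j - eps R j * E m)).
  have -> : (-1) ^+ (w - u) =
      - ((-1) ^+ (if (m < k)%N then val m else m.+1) * (-1) ^+ k) :> R.
    rewrite -exprD -[RHS]mulN1r -exprS -signr_odd -[RHS]signr_odd; congr (_ ^+ _).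
    rewrite /u /w; case: ltnP => h; congr nat_of_bool.
      have -> : ((m + k).+1 = (k - m.+1) + m.+1.*2)%N by lia.
      by rewrite oddD odd_double addbF.
    have -> : ((m.+1 + k).+1 = (m - k) + k.+1.*2)%N by lia.
    by rewrite oddD odd_double addbF.
  by ring.
rewrite mulr_ge0 ?sqr_ge0 // -(prod_nat_range (-1) uw) (bigD1 m) //= mN mul1r.
rewrite -big_split /=; apply: prodr_ge0 => j jm.
rewrite pole_factor_diff.
have [mj|jm'|e] := ltngtP m j; last by rewrite (val_inj e) eqxx in jm.
- have := a_decr mj; have [jk|jk] := ltnP j k.
    have [-> _] := E_pos jk; rewrite /u /w (ltn_trans mj jk) /= mj jk /=; lra.
  have [-> _] := E_neg jk; case: ifP; last by rewrite mulN1r mul1r; lra.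
  rewrite /u /w; case: ltnP => h; first by rewrite (ltnNge j k) jk andbF.
  by rewrite (ltnNge j m) (ltnW mj) andbF.
- have := a_decr jm'; have [jk|jk] := ltnP j k.
    have [-> _] := E_pos jk; case: ifP; last by rewrite !mul1r; lra.
    rewrite /u /w; case: ltnP => h; first by rewrite (leqNgt m.+1 j) ltnS (ltnW jm').
    by rewrite (leqNgt k j) jk.
  have [-> _] := E_neg jk; rewrite /u /w (ltnNge m k) (leq_trans jk (ltnW jm')) /=.
  by rewrite jk jm' /=; lra.
Qed.

(** The poles with 0 inserted give [k + l + 1] nodes at which the Jacobi polynomial, up to the sign
    [(-1) ^+ k], weakly alternates; at 0 this is the hypothesis on [x]. *)
Lemma jacobi_factorization x : qform a 0 x x <= 1 ->
  exists L, interlaced L /\ jacobi_factors x L.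
Proof.
move=> x_in; pose i0 : 'I_(k + l) := Ordinal (ltn_addr l hk).
pose e n := E (insubd i0 n).
have eE (i : 'I_(k + l)) : e i = E i by rewrite /e valKd.
have eN n (h : (n < k + l)%N) : e n = E (Ordinal h) by rewrite -eE.
pose y n := if (n < k)%N then e n else if n == k then 0 else e n.-1.
have y_lt n : (n < k)%N -> y n = e n by rewrite /y => ->.
have y_k : y k = 0 by rewrite /y ltnn eqxx.
have y_gt n : (k <= n)%N -> y n.+1 = e n.
  by rewrite /y => h; rewrite ltnNge ltnW ?gtn_eqF.
have e_gt0 n : (n < k)%N -> 0 < e n.
  move=> h; have h' := ltn_addr l h; rewrite (eN _ h').
  by have [_ ->] := E_pos (i := Ordinal h') h; exact: a_gt0.
have e_lt0 n : (k <= n < k + l)%N -> e n < 0.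
  move=> /andP[h h']; rewrite (eN _ h').
  by have [_ ->] := E_neg (i := Ordinal h') h; rewrite oppr_lt0.
have ydec i : (i < k + l)%N -> y i.+1 < y i.
  move=> ikl; have [ik|ki|ik] := ltngtP i k.
  - rewrite (y_lt i) //; have [|] := boolP (i.+1 < k)%N.
      move=> h; have h' := ltn_addr l h; rewrite y_lt // (eN _ h') (eN _ ikl).
      by apply: a_decr; exact: ltnSn.
    rewrite -leqNgt => h; have -> : i.+1 = k by apply/eqP; rewrite eqn_leq ik h.
    by rewrite y_k e_gt0.
  - rewrite y_gt ?(ltnW ki) //; case: i ki ikl => // i ki ikl.
    by rewrite y_gt // (eN _ ikl) (eN _ (ltnW ikl)); apply: a_decr; exact: ltnSn.
  - by rewrite ik y_k y_gt // e_lt0 // leqnn -{1}ik.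
pose p := (-1) ^+ k *: jacobi_poly a x.
have [szJ leadJ] := size_lead_jacobi x.
have szp : size p = (k + l).+1 by rewrite size_scale ?signr_eq0.
have sgn i : (i <= k + l)%N -> 0 <= (-1) ^+ i * p.[y i].
  move=> ikl; rewrite hornerZ; have [ik|ki|->] := ltngtP i k.
  - rewrite y_lt //; have h := ltn_addr l ik; rewrite (eN _ h).
    by have := jacobi_sign_at_pole x (Ordinal h); rewrite /= ik.
  - case: i ki ikl => // i; rewrite ltnS => ki h; rewrite y_gt // (eN _ h).
    by have := jacobi_sign_at_pole x (Ordinal h); rewrite /= ltnNge ki.
  - rewrite y_k mulrA -expr2 sqrr_sign mul1r horner_jacobi.
    have -> : pole_prod a ep 0 - pole_sum a ep (fun i => x 0 i ^+ 2) 0 =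
        (1 - qform a 0 x x) * \prod_i a i.
      rewrite mulrBl mul1r; congr (_ - _).
        by apply: eq_bigr => j _; rewrite mulr0 subr0.
      rewrite mulr_suml; apply: eq_bigr => j _; rewrite [\prod_i a i](bigD1 j) //= mulr0 subr0.
      rewrite mulrA divfK ?gt_eqF // expr2; congr (_ * _).
      by apply: eq_bigr => m _; rewrite mulr0 subr0.
    by rewrite mulr_ge0 ?subr_ge0 // prodr_ge0 // => j _; exact: ltW.
have [z [zy pE]] := weakly_alternating_roots szp ydec sgn.
(* Thanks to the inserted 0, the [i]-th gap has [E i] as its upper end for [i < k] and as its lower
   end for [k <= i], so the roots keep their indices. *)
exists (fun i => z (val i)); split.
  move=> i; have /andP[z1 z2] := zy _ (ltn_ord i); have [ik|ki] := ltnP i k.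
    have [ei eia] := E_pos ik; rewrite ei mul1r.
    rewrite (y_lt _ ik) eE eia in z2; rewrite z2 andbT.
    have zm m : (i < m < k)%N -> e m <= z i.
      move=> /andP[im mk]; apply: le_trans z1.
      have ik1 : (i.+1 < k)%N by apply: leq_ltn_trans mk.
      have h := ltn_addr l ik1; have h' := ltn_addr l mk.
      by rewrite y_lt // (eN _ h) (eN _ h'); apply: E_antitone.
    split=> [|m em ami].
      have [ik1|] := ltnP i.+1 k; first by apply: (le_trans (ltW (e_gt0 _ ik1))); apply: zm;
        rewrite ltnSn ik1.
      move=> h; have ik1 : i.+1 = k by apply/eqP; rewrite eqn_leq ik h.
      by move: z1; rewrite ik1 y_k.
    have mk : (m < k)%N by apply/(eps_eq1 R).
    have [_ <-] := E_pos mk; rewrite -eE; apply: zm; rewrite mk andbT ltnNge.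
    apply/negP => mi; have := E_antitone mi; have [_ ->] := E_pos mk.
    by rewrite eia leNgt ami.
  have [ei eia] := E_neg ki; rewrite ei mulN1r oppr_ge0.
  rewrite (y_gt _ ki) eE eia in z1; rewrite lerNl z1 andbT.
  have zm m : (k <= m < i)%N -> z i <= e m.
    move=> /andP[km mi]; apply: (le_trans z2).
    case: (val i) (ltn_ord i) mi => // i' i'kl mi.
    rewrite y_gt; last exact: leq_trans km mi.
    have h := ltnW i'kl; have h' : (m < k + l)%N by apply: leq_ltn_trans h.
    by rewrite (eN _ h) (eN _ h'); apply: E_antitone.
  split=> [|m em ami].
    have [ik'|ik] := eqVneq (val i) k; first by move: z2;
      rewrite -[nat_of_ord i]/(val i) ik' y_k.
    have ki' : (k < i)%N by rewrite ltn_neqAle eq_sym ik ki.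
    apply: (@le_trans _ _ (e k)); first by apply: zm; rewrite leqnn.
    by apply/ltW/e_lt0; rewrite leqnn (leq_trans ki') // ltnW.
  have km : (k <= m)%N by apply/(eps_eqN1 R).
  have [_ eEm] := E_neg km; rewrite lerNr -eEm -eE; apply: zm.
  rewrite km /= ltnNge; apply/negP => im; have := E_antitone im.
  by rewrite eEm eia lerN2 leNgt ami.
move=> mu; rewrite -horner_jacobi.
have -> : jacobi_poly a x = (-1) ^+ k *: p by rewrite scalerA -expr2 sqrr_sign scale1r.
rewrite pE lead_coefZ leadJ scalerA mulrA -expr2 sqrr_sign mul1r hornerZ.
rewrite horner_prod -big_split /=; apply: eq_bigr => i _.
by rewrite hornerXsubC; ring.
Qed.

End Ellipsoid.

(** * Sign of the confocal form inside a gap *)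

Section Gaps.
Variables (R : realType) (k l : nat) (a : 'I_(k + l) -> R).
Hypothesis hk : (1 <= k)%N.
Hypothesis hl : (1 <= l)%N.
Hypothesis a_gt0 : forall i, 0 < a i.
Hypothesis a_decr : forall i j : 'I_(k + l), (i < j)%N ->
  eps R j * a j < eps R i * a i.

Local Notation ep := (@eps R k l).
Local Notation E i := (eps R i * a i).

Lemma pole_prod_neq0 mu : regular a mu -> pole_prod a ep mu != 0.
Proof. by move=> reg; apply/prodf_neq0 => i _; exact: reg. Qed.

Lemma qform_clear mu x y : regular a mu ->
  qform a mu x y * pole_prod a ep mu =
  pole_sum a ep (fun i => x 0 i * y 0 i) mu.
Proof.
move=> reg; rewrite mulr_suml; apply: eq_bigr => i _.
by rewrite /pole_prod (bigD1 i) //= mulrA divfK //; exact: reg.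
Qed.

Lemma qform_clear_sqr mu x : regular a mu ->
  qform a mu x x * pole_prod a ep mu =
  pole_sum a ep (fun i => x 0 i ^+ 2) mu.
Proof. by move/qform_clear ->; apply: eq_bigr => i _; rewrite expr2. Qed.

Lemma qformDl mu x y z : qform a mu (x + y) z = qform a mu x z + qform a mu y z.
Proof.
rewrite -big_split; apply: eq_bigr => i _; rewrite !mxE /=.
by rewrite !mulrDl.
Qed.

Lemma qformZl mu c x z : qform a mu (c *: x) z = c * qform a mu x z.
Proof. by rewrite mulr_sumr; apply: eq_bigr => i _; rewrite !mxE !mulrA. Qed.

Lemma qformC mu x y : qform a mu x y = qform a mu y x.
Proof. by apply: eq_bigr => i _; rewrite [x 0 i * _]mulrC. Qed.

Lemma qformDr mu x y z : qform a mu z (x + y) = qform a mu z x + qform a mu z y.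
Proof. by rewrite qformC qformDl !(qformC mu z). Qed.

Lemma qformZr mu c x z : qform a mu z (c *: x) = c * qform a mu z x.
Proof. by rewrite qformC qformZl (qformC mu z). Qed.

Lemma qform_line mu c x v : qform a mu (x + c *: v) (x + c *: v) =
  qform a mu x x + 2 * c * qform a mu x v + c ^+ 2 * qform a mu v v.
Proof.
by rewrite qformDl !qformDr !qformZl !qformZr (qformC mu v x); ring.
Qed.

(** The form is a quarter of the discriminant of [qform a lam (x + t v) (x + t v) - 1] as a
    quadratic in [t], hence invariant under a shift of [t]. *)
Lemma tangency_form_line lam c x v :
  tangency_form a lam (x + c *: v) v = tangency_form a lam x v.
Proof.
by rewrite /tangency_form qform_line qformDl qformZl; ring.
Qed.

Lemma jacobi_prod mu x L : jacobi_factors a x L -> regular a mu ->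
  1 - qform a mu x x = \prod_i ((L i - mu) / (E i - mu)).
Proof.
move=> J reg; have Pi0 := pole_prod_neq0 reg.
apply: (mulIf Pi0); rewrite mulrBl mul1r qform_clear_sqr // J.
rewrite /pole_prod -big_split /=; apply: eq_bigr => i _.
have := reg i; rewrite pole_factor_diff mulf_eq0 negb_or => /andP[_ h].
by rewrite mulrCA divfK.
Qed.

Lemma a_sign_inj i m : eps R m = eps R i -> a m = a i -> m = i.
Proof.
move=> em am; apply/val_inj; case: (ltngtP m i) => // /a_decr.
  by rewrite em am ltxx.
by rewrite em am ltxx.
Qed.

Lemma open_gap_regular i mu : open_gap a i mu -> regular a mu.
Proof.
move=> [/andP[mu0 mua] h] m; apply/eqP => hm.
have := a_gt0 m; have := h m.
have [em|em] : eps R m = eps R i \/ eps R m = - eps R i.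
- by case: (eps_sign R m) => ->; case: (eps_sign R i) => ->;
     rewrite ?opprK; [left|right|right|left].
- move=> /(_ em); rewrite em in hm; have -> : a m = eps R i * mu by lra.
  by rewrite ltxx => /(_ mua).
- by rewrite em in hm; lra.
Qed.

Lemma interlaced_open_gap L i : interlaced a L -> regular a (L i) -> L i != 0 ->
  open_gap a i (L i).
Proof.
move=> IL reg L0; have [/andP[L1 L2] h] := IL i.
have ne m : eps R i * L i != a m \/ eps R m != eps R i.
  have [em|em] := eqVneq (eps R m) (eps R i); [left|by right].
  by have := reg m; rewrite subr_eq0 em eq_sym.
split.
  rewrite !lt_neqAle L1 L2 !andbT eq_sym mulf_neq0 //=.
    by case: (ne i) => //; rewrite eqxx.
  by case: (eps_sign R i) => ->; rewrite ?oppr_eq0 oner_neq0.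
move=> m em ami; rewrite lt_neqAle h // andbT eq_sym.
by case: (ne m) => //; rewrite em eqxx.
Qed.

Lemma interlaced_bound L i : interlaced a L -> `|L i| <= a i.
Proof.
move=> /(_ i)[/andP[L1 L2] _]; rewrite ler_norml.
by move: L1 L2; case: (eps_sign R i) => -> L1 L2; lra.
Qed.

(** The [m]-th closed gap, which contains both [L m] and [E m], lies entirely on one side of the
    open gap of [i]. *)
Lemma gap_ratio_gt0 L i m mu : interlaced a L -> open_gap a i mu -> m != i ->
  0 < (L m - mu) / (E m - mu).
Proof.
move=> IL [/andP[mu0 mua] gap] mi.
suff h : 0 < (L m - mu) * (E m - mu).
  have Em : E m - mu != 0.
    by apply/eqP => e; move: h; rewrite e mulr0 ltxx.
  have -> : (L m - mu) / (E m - mu) = (L m - mu) * (E m - mu) / (E m - mu) ^+ 2.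
    by field.
  by rewrite divr_gt0 // lt_neqAle sqr_ge0 eq_sym expf_neq0.
have [/andP[L1 L2] Lm] := IL m; have am := a_gt0 m.
have ai := a_gt0 i; have g := gap m.
have [em|em] : eps R m = eps R i \/ eps R m = - eps R i.
- by case: (eps_sign R m) => ->; case: (eps_sign R i) => ->;
     rewrite ?opprK; [left|right|right|left].
- have nai : a m != a i by apply: contraNneq mi => /(a_sign_inj em) ->.
  have Lmi := Lm i (esym em); rewrite em in L1 L2 Lmi *; have {}g := g em.
  have [ami|aim] : a m < a i \/ a i < a m by apply/orP; rewrite -neq_lt.
    have {}g := g ami; case: (eps_sign R i) => e; rewrite e in g mu0 mua L1 L2 *; nra.
  have {}Lmi := Lmi aim.
  by case: (eps_sign R i) => e; rewrite e in Lmi mu0 mua L1 L2 *; nra.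
- rewrite em in L1 L2 *.
  by case: (eps_sign R i) => e; rewrite e in mu0 mua L1 L2 *; nra.
Qed.

(* Only the [i]-th factor of the product formula changes sign inside the
   [i]-th gap, so [1 - qform a mu x x] decides on which side of [mu] the
   [i]-th coordinate lies. *)
Lemma gap_sign i mu : open_gap a i mu ->
  exists B, forall x L, interlaced a L -> jacobi_factors a x L ->
    exists c, 0 < c <= B /\ 1 - qform a mu x x = eps R i * (L i - mu) * c.
Proof.
move=> gap; have reg := open_gap_regular gap.
have [/andP[mu0 mua] _] := gap.
(* Since each [L m] is at most [a m] in absolute value, this bound is independent of the point [x];
   the comparison of derivatives relies on that uniformity. *)
exists (\prod_(m | m != i) ((a m + `|mu|) / `|E m - mu|) / (a i - eps R i * mu)).
move=> x L IL JL.
exists (\prod_(m | m != i) ((L m - mu) / (E m - mu)) / (a i - eps R i * mu)).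
have d0 : 0 < a i - eps R i * mu by rewrite subr_gt0.
split; last first.
  rewrite (jacobi_prod JL reg) (bigD1 i) //= pole_factor_diff.
  have E0 : E i - mu != 0.
    by move: d0; rewrite pole_factor_diff; case: eqVneq => // ->; rewrite mulr0 ltxx.
  set p := \prod_(_ | _) _.
  case: (eps_sign R i) => e; rewrite e in E0 *; field => //.
  by move: E0; rewrite mul1r.
have pos m : m != i -> 0 < (L m - mu) / (E m - mu) by exact: gap_ratio_gt0.
rewrite divr_gt0 ?prodr_gt0 //= ler_pM2r ?invr_gt0 //.
apply: ler_prod => m mi; rewrite ltW ?pos //=.
rewrite -[leLHS]gtr0_norm ?pos // normrM normfV ler_wpM2r ?invr_ge0 //.
by rewrite (le_trans (ler_normB _ _)) // lerD2r interlaced_bound.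
Qed.

End Gaps.

(** * Counting the caustics on either side of 0 *)

Lemma pole_prod_opp (R : realType) (I : finType) (a ep : I -> R) mu :
  pole_prod a (fun i => - ep i) mu = pole_prod a ep (- mu).
Proof. by apply: eq_bigr => i _; rewrite mulrN mulNr. Qed.

Lemma pole_sum_opp (R : realType) (I : finType) (a ep u : I -> R) mu :
  pole_sum a (fun i => - ep i) u mu = pole_sum a ep u (- mu).
Proof.
apply: eq_bigr => i _; congr (_ * _).
by apply: eq_bigr => j _; rewrite mulrN mulNr.
Qed.

Section Counting.
Variables (R : realType) (k l : nat) (a : 'I_(k + l) -> R).
Hypothesis hk : (1 <= k)%N.
Hypothesis hl : (1 <= l)%N.
Hypothesis a_gt0 : forall i, 0 < a i.
Hypothesis a_decr : forall i j : 'I_(k + l), (i < j)%N ->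
  eps R j * a j < eps R i * a i.

Local Notation ep := (@eps R k l).
Local Notation E i := (eps R i * a i).
Local Notation npos s := (count (fun r : R => 0 < r) s).

(** Clearing denominators proves the identity away from the poles; as an identity of polynomials it
    then extends to them. *)
Lemma tangency_poly_clear x v P mu : tangency_poly a x v P ->
  P.[mu] * pole_prod a ep mu =
  pole_sum a ep (fun i => x 0 i * v 0 i) mu ^+ 2 +
  pole_sum a ep (fun i => v 0 i ^+ 2) mu *
    (pole_prod a ep mu - pole_sum a ep (fun i => x 0 i ^+ 2) mu).
Proof.
move=> TP.
pose PPi := \prod_i pole_factor a ep i.
pose D := P * PPi - (pole_sum_poly a ep (fun i => x 0 i * v 0 i) ^+ 2 +
  pole_sum_poly a ep (fun i => v 0 i ^+ 2) *
    (PPi - pole_sum_poly a ep (fun i => x 0 i ^+ 2))).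
have hD m : D.[m] = P.[m] * pole_prod a ep m -
  (pole_sum a ep (fun i => x 0 i * v 0 i) m ^+ 2 +
  pole_sum a ep (fun i => v 0 i ^+ 2) m *
    (pole_prod a ep m - pole_sum a ep (fun i => x 0 i ^+ 2) m)).
  rewrite /D expr2 !(hornerD, hornerN, hornerM).
  by rewrite !horner_pole_sum !horner_pole_prod expr2.
suff D0 : D = 0.
  by apply/eqP; rewrite -subr_eq0 -hD D0 horner0.
apply: (@poly_eq0_off _ PPi).
  by apply/prodf_neq0 => i _; exact: pole_factor_neq0.
move=> m; rewrite horner_pole_prod => /prodf_neq0 reg.
have {}reg : regular a m by move=> i; exact: reg.
have := TP m reg; rewrite -/(pole_prod a ep m) => T.
have Pi0 := pole_prod_neq0 reg.
rewrite hD -!qform_clear_sqr // -qform_clear //.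
have -> : P.[m] = tangency_form a m x v * pole_prod a ep m.
  by rewrite T divfK.
by rewrite /tangency_form; ring.
Qed.

Section Line.
Variables (x v : 'rV[R]_(k + l)) (L : 'I_(k + l) -> R) (C : R) (s : seq R).
Hypothesis IL : interlaced a L.
Hypothesis JL : jacobi_factors a x L.
Hypothesis TP : tangency_poly a x v (C *: \prod_(r <- s) ('X - r%:P)).
Hypothesis P0_gt0 : 0 < C * \prod_(r <- s) (0 - r).

Let clear mu : C * \prod_(r <- s) (mu - r) * pole_prod a ep mu =
  pole_sum a ep (fun i => x 0 i * v 0 i) mu ^+ 2 +
  pole_sum a ep (fun i => v 0 i ^+ 2) mu *
    (pole_prod a ep mu - pole_sum a ep (fun i => x 0 i ^+ 2) mu).
Proof.
rewrite -(tangency_poly_clear _ TP) hornerZ horner_prod.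
by congr (_ * _ * _); apply: eq_bigr => r _; rewrite hornerXsubC.
Qed.

Let i0 : 'I_(k + l) := Ordinal (ltn_addr l hk).

(** Among the positive poles [a] decreases with the index, so the enumeration by increasing [a] runs
    backwards; among the negative ones, [gn] runs forwards. *)
Let gp j : 'I_(k + l) := insubd i0 (k.-1 - j)%N.
Let val_gp j : val (gp j) = (k.-1 - j)%N.
Proof. by rewrite val_insubd ifT // ltn_addr //; lia. Qed.

Let gn j : 'I_(k + l) := insubd i0 (k + j)%N.
Let val_gn j : (j < l)%N -> val (gn j) = (k + j)%N.
Proof. by move=> jl; rewrite val_insubd ltn_add2l jl. Qed.

Let a_incr_neg (i m : 'I_(k + l)) : (k <= i)%N -> (i < m)%N -> a i < a m.
Proof.
move=> ki im; have := a_decr im.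
rewrite (E_neg _ ki).2 (E_neg _ _).2 ?ltrN2 //; exact: leq_trans (ltnW im).
Qed.

Let a_decr_pos (i m : 'I_(k + l)) : (m < k)%N -> (i < m)%N -> a m < a i.
Proof.
move=> mk im; have := a_decr im.
by rewrite (E_pos _ mk).2 (E_pos _ _).2 //; exact: ltn_trans mk.
Qed.

Lemma pos_counts : (k <= (npos s).+1)%N /\
  forall i : 'I_(k + l), (i < k)%N -> (k.-1 - i <= count_oc s (L i))%N /\
    ((npos s <= k)%N -> (count_oo s (L i) <= k.-1 - i)%N).
Proof.
have ltk j : (gp j < k)%N by rewrite -[nat_of_ord _]/(val _) val_gp; lia.
have gpos j : (j < k)%N -> eps R (gp j) = 1 by move=> _; apply/eps_eq1.
have gsurj i : eps R i = 1 -> exists2 j, (j < k)%N & i = gp j.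
  move=> /eps_eq1 ik; exists (k.-1 - i)%N; first by lia.
  by apply/val_inj; rewrite val_gp /=; lia.
have gincr i j : (i < j < k)%N -> a (gp i) < a (gp j).
  by move=> ij; apply: a_decr_pos; rewrite // -![nat_of_ord _]/(val _) !val_gp; lia.
have L0 j : (j < k)%N -> 0 <= L (gp j).
  by move=> jk; have [/andP[]] := IL (gp j); rewrite gpos // mul1r.
have Lle j : (j < k)%N -> L (gp j) <= a (gp j).
  by move=> jk; have [/andP[_]] := IL (gp j); rewrite gpos // mul1r.
have Lge i j : (i < j < k)%N -> a (gp i) <= L (gp j).
  move=> ij; have /andP[ij' jk] := ij; have ik := ltn_trans ij' jk.
  have [_ /(_ (gp i))] := IL (gp j); rewrite !gpos // mul1r; apply=> //.
  exact: gincr.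
have Lneg i : eps R i = -1 -> L i <= 0.
  by move=> ei; have [/andP[+ _] _] := IL i; rewrite ei mulN1r oppr_ge0.
have sgn := @eps_sign R k l.
split; first exact: (half_count_total sgn a_gt0 JL clear P0_gt0
    gpos gsurj gincr L0 Lle Lge Lneg).
move=> i ik; have [j jk ij] := gsurj i ((eps_eq1 R i).2 ik).
have -> : (k.-1 - i = j)%N by rewrite ij -[nat_of_ord _]/(val _) val_gp; lia.
rewrite ij; split.
  exact: (half_count_oc sgn a_gt0 JL clear P0_gt0
    gpos gsurj gincr L0 Lle Lge Lneg).
by move=> h; exact: (half_count_oo sgn a_gt0 JL clear P0_gt0
    gpos gsurj gincr L0 Lle Lge Lneg).
Qed.

(* The reflection [lambda -> - lambda] exchanges the roles of the two signs. *)
Lemma neg_counts : (l <= (npos [seq (- r)%R | r <- s]).+1)%N /\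
  forall i : 'I_(k + l), (k <= i)%N ->
    (i - k <= count_oc [seq (- r)%R | r <- s] (- L i))%N /\
    ((npos [seq (- r)%R | r <- s] <= l)%N ->
       (count_oo [seq (- r)%R | r <- s] (- L i) <= i - k)%N).
Proof.
set s' := [seq - r | r <- s].
pose ep' (i : 'I_(k + l)) := - eps R i; pose L' i := - L i.
have sgn i : ep' i = 1 \/ ep' i = -1.
  by rewrite /ep'; case: (eps_sign R i) => ->; rewrite ?opprK; [right|left].
have JL' mu : pole_prod a ep' mu - pole_sum a ep' (fun i => x 0 i ^+ 2) mu =
    \prod_i (ep' i * (L' i - mu)).
  rewrite pole_prod_opp pole_sum_opp JL; apply: eq_bigr => i _.
  by rewrite /ep' /L'; ring.
(* Negating the roots and the variable changes each linear factor by a sign, which the leading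
   coefficient takes up. *)
have prodN mu : C * (-1) ^+ size s * \prod_(r <- s') (mu - r) =
    C * \prod_(r <- s) (- mu - r).
  rewrite big_map -mulrA; congr (_ * _).
  have -> : (-1) ^+ size s = \prod_(r <- s) (-1) :> R.
    by rewrite big_const_seq count_predT iter_mulr_1.
  by rewrite -big_split; apply: eq_bigr => r _ /=; ring.
have clear' mu : C * (-1) ^+ size s * \prod_(r <- s') (mu - r) * pole_prod a ep' mu =
  pole_sum a ep' (fun i => x 0 i * v 0 i) mu ^+ 2 +
  pole_sum a ep' (fun i => v 0 i ^+ 2) mu *
    (pole_prod a ep' mu - pole_sum a ep' (fun i => x 0 i ^+ 2) mu).
  by rewrite pole_prod_opp !pole_sum_opp prodN clear.
have P0' : 0 < C * (-1) ^+ size s * \prod_(r <- s') (0 - r).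
  by rewrite prodN oppr0.
have ep1 (i : 'I_(k + l)) : (k <= i)%N -> ep' i = 1.
  by move=> /(eps_eqN1 R) h; rewrite /ep' h opprK.
have ltk j : (j < l)%N -> (k <= gn j)%N.
  by move=> jl; rewrite -[nat_of_ord _]/(val _) val_gn // leq_addr.
have gpos j : (j < l)%N -> ep' (gn j) = 1 by move=> jl; apply: ep1; exact: ltk.
have gsurj i : ep' i = 1 -> exists2 j, (j < l)%N & i = gn j.
  rewrite /ep' => h; have ki : (k <= i)%N.
    by apply/(eps_eqN1 R); rewrite -h opprK.
  have il : (i - k < l)%N by have := ltn_ord i; lia.
  exists (i - k)%N => //.
  by apply/val_inj; rewrite val_gn //= subnKC.
have gincr i j : (i < j < l)%N -> a (gn i) < a (gn j).
  move=> /andP[ij jl]; have il := ltn_trans ij jl; apply: a_incr_neg; first exact: ltk.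
  by rewrite -![nat_of_ord _]/(val _) !val_gn // ltn_add2l.
have epL i : ep' i * L' i = eps R i * L i by rewrite /ep' /L' mulrNN.
have L0 j : (j < l)%N -> 0 <= L' (gn j).
  by move=> jk; have [/andP[]] := IL (gn j); rewrite -epL gpos // mul1r.
have Lle j : (j < l)%N -> L' (gn j) <= a (gn j).
  by move=> jk; have [/andP[_]] := IL (gn j); rewrite -epL gpos // mul1r.
have Lge i j : (i < j < l)%N -> a (gn i) <= L' (gn j).
  move=> ij; have /andP[ij' jk] := ij; have ik := ltn_trans ij' jk.
  have [_ /(_ (gn i))] := IL (gn j); rewrite -epL gpos // mul1r; apply=> //.
    by apply: oppr_inj; rewrite -[LHS]/(ep' _) -[RHS]/(ep' _) !gpos.
  exact: gincr.
have Lneg i : ep' i = -1 -> L' i <= 0.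
  by move=> ei; have [/andP[+ _] _] := IL i; rewrite -epL ei mulN1r oppr_ge0.
split; first exact: (half_count_total sgn a_gt0 JL' clear' P0'
    gpos gsurj gincr L0 Lle Lge Lneg).
move=> i ki; have [j jl ij] := gsurj i (ep1 i ki).
have -> : (i - k = j)%N by rewrite ij -[nat_of_ord _]/(val _) val_gn // addKn.
rewrite ij; split.
  exact: (half_count_oc sgn a_gt0 JL' clear' P0'
    gpos gsurj gincr L0 Lle Lge Lneg).
by move=> h; exact: (half_count_oo sgn a_gt0 JL' clear' P0'
    gpos gsurj gincr L0 Lle Lge Lneg).
Qed.

End Line.
End Counting.

(** * The segments of (PE3) *)

Lemma count_enum_range (n u w : nat) : (u <= w <= n)%N ->
  count (fun i : 'I_n => u <= i < w)%N (enum 'I_n) = (w - u)%N.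
Proof.
move=> /andP[uw wn].
have -> : count (fun i : 'I_n => u <= i < w)%N (enum 'I_n) =
    count (fun i => u <= i < w)%N (iota 0 n).
  by rewrite -val_enum_ord count_map.
have -> : n = (u + ((w - u) + (n - w)))%N by lia.
rewrite !iotaD !count_cat add0n subnKC //.
have -> : count (fun i => u <= i < w)%N (iota 0 u) = 0%N.
  apply/eqP; rewrite eqn0Ngt -has_count; apply/hasPn => i.
  by rewrite mem_iota; lia.
have -> : count (fun i => u <= i < w)%N (iota w (n - w)) = 0%N.
  apply/eqP; rewrite eqn0Ngt -has_count; apply/hasPn => i.
  by rewrite mem_iota; lia.
rewrite addn0 add0n -[RHS](size_iota u) -[RHS]count_predT.
by apply: eq_in_count => i; rewrite mem_iota subnKC // => ->.
Qed.

(** In a sorted list, having at least [2j] entries at most [r] bounds the [2j]-th entry from above,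
    and having at most [2j] entries below [r] bounds the next one from below. For [j = 0] the left
    end is the prepended 0. *)
Lemma nth_bracket (R : realType) (B : seq (\bar R)) (r : R) (j : nat) :
  sorted <=%O B -> 0 <= r -> (j.*2 < size B)%N ->
  (count (fun y => y < r%:E)%E B <= j.*2)%N ->
  (j.*2 <= count (fun y => y <= r%:E)%E B)%N ->
  (nth 0%E (0%E :: B) j.*2 <= r%:E)%E /\
  (r%:E <= nth 0%E (0%E :: B) j.*2.+1)%E.
Proof.
move=> sB r0 szB c1 c2; split; last first.
  by apply: (nth_count_ge 0%E sB); apply/andP; split.
case: j c2 {c1 szB} => [|j] c2 /=; first by rewrite lee_fin.
by apply: nth_count_le.
Qed.

Definition finite_part (R : realType) (s : seq (\bar R)) : seq R :=
  [seq fine y | y <- s & y != +oo%E].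

Lemma count_finite_part (R : realType) (s : seq (\bar R))
    (Q : pred (\bar R)) (Q' : pred R) :
  (-oo%E \notin s) -> ~~ Q +oo%E -> (forall r, Q r%:E = Q' r) ->
  count Q s = count Q' (finite_part s).
Proof.
move=> sN QN QQ'; rewrite /finite_part count_map count_filter.
apply: eq_in_count => -[r| |] //= ys; first by rewrite QQ' andbT.
- by rewrite andbF (negPf QN).
- by rewrite ys in sN.
Qed.

Section Segments.
Variables (R : realType) (k l : nat) (a : 'I_(k + l) -> R).
Hypothesis hk : (1 <= k)%N.
Hypothesis hl : (1 <= l)%N.
Hypothesis a_gt0 : forall i, 0 < a i.
Hypothesis a_decr : forall i j : 'I_(k + l), (i < j)%N ->
  eps R j * a j < eps R i * a i.
Variables (alpha : (k + l).-1.-tuple (\bar R)) (b c : seq (\bar R)).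
Hypothesis alphaN : -oo%E \notin alpha.
Hypothesis bc_multiset : perm_eq (b ++ c)
  ([seq (eps R i * a i)%:E | i <- enum 'I_(k + l)] ++ alpha).
Hypothesis b_sorted : sorted <=%O b.
Hypothesis b_gt0 : forall y, y \in b -> (0 < y)%E.
Hypothesis c_sorted : sorted >=%O c.
Hypothesis c_lt0 : forall y, y \in c -> (y < 0)%E.

Local Notation ep := (@eps R k l).
Local Notation E i := (eps R i * a i).
Local Notation npos s := (count (fun r : R => 0 < r) s).

Let s := finite_part alpha.
Let s' := [seq - r | r <- s].

Let count_bc (Q : pred (\bar R)) : (count Q b + count Q c =
  count (fun i : 'I_(k + l) => Q (E i)%:E) (enum 'I_(k + l)) + count Q alpha)%N.
Proof. by rewrite -count_cat (permP bc_multiset) count_cat count_map. Qed.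

Let count_b (Q : pred (\bar R)) : count Q b =
  (count (fun i : 'I_(k + l) => (0 < (E i)%:E)%E && Q (E i)%:E) (enum 'I_(k + l)) +
   count (fun y => (0 < y)%E && Q y) alpha)%N.
Proof.
have := count_bc (fun y => (0 < y)%E && Q y).
rewrite [X in (X + _)%N = _](eq_in_count (a2 := Q)); last by move=> y /b_gt0 ->.
rewrite [X in (_ + X)%N = _](eq_in_count (a2 := pred0)) ?count_pred0 ?addn0 //.
by move=> y /c_lt0 y0 /=; rewrite ltNge ltW.
Qed.

Let count_c (Q : pred (\bar R)) : count Q c =
  (count (fun i : 'I_(k + l) => ((E i)%:E < 0)%E && Q (E i)%:E) (enum 'I_(k + l)) +
   count (fun y => (y < 0)%E && Q y) alpha)%N.
Proof.
have := count_bc (fun y => (y < 0)%E && Q y).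
rewrite [X in (_ + X)%N = _](eq_in_count (a2 := Q)); last by move=> y /c_lt0 ->.
rewrite [X in (X + _)%N = _](eq_in_count (a2 := pred0)) ?count_pred0 //.
by move=> y /b_gt0 y0 /=; rewrite ltNge ltW.
Qed.

Let E_gt0 (i : 'I_(k + l)) : (0 < E i) = (i < k)%N.
Proof.
case: ltnP => h; first by rewrite (E_pos a h).2 a_gt0.
by rewrite (E_neg a h).2 oppr_gt0 ltNge ltW.
Qed.

Let E_lt0 (i : 'I_(k + l)) : (E i < 0) = (k <= i)%N.
Proof.
rewrite leqNgt; case: (ltnP i k) => h; first by rewrite (E_pos a h).2 ltNge ltW.
by rewrite (E_neg a h).2 oppr_lt0 a_gt0.
Qed.

(** Only an inequality, since caustics equal to [+oo] also belong to [b] while [s] omits them. *)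
Lemma size_b_ge : (k + npos s <= size b)%N.
Proof.
rewrite -(count_predT b) count_b; apply: leq_add.
  rewrite -[X in (X <= _)%N](subn0 k) -(@count_enum_range (k + l)) ?leq_addr //.
  by apply: sub_count => i /= ik; rewrite andbT lte_fin E_gt0.
rewrite /s /finite_part count_map count_filter.
by apply: sub_count => -[r| |] //=; rewrite ?andbT ?lte_fin ?ltxx.
Qed.

Lemma size_c_ge : (l + npos s' <= size c)%N.
Proof.
rewrite -(count_predT c) count_c; apply: leq_add.
  rewrite -[X in (X <= _)%N](addKn k) -(@count_enum_range (k + l)) ?leq_addr ?leqnn //.
  by apply: sub_count => i /= /andP[ik _]; rewrite andbT lte_fin E_lt0.
rewrite /s' /s /finite_part !count_map count_filter.
by apply: sub_count => -[r| |] //=; rewrite ?andbT ?lte_fin ?oppr_gt0 ?ltxx.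
Qed.

Lemma npos_sum : (npos s + npos s' <= k + l - 1)%N.
Proof.
have : (size s <= k + l - 1)%N.
  rewrite /s /finite_part size_map size_filter subn1.
  by apply: leq_trans (count_size _ _) _; rewrite size_tuple.
move=> h; apply: leq_trans h; rewrite [X in (_ + X)%N]count_map -count_predUI.
rewrite [X in (_ + X)%N](eq_count (a2 := pred0)) ?count_pred0 ?addn0 ?count_size //.
by move=> r /=; rewrite oppr_gt0; case: ltgtP.
Qed.

Section Line.
Variables (x v : 'rV[R]_(k + l)) (L : 'I_(k + l) -> R) (C : R).
Hypothesis IL : interlaced a L.
Hypothesis JL : jacobi_factors a x L.
Hypothesis TP : tangency_poly a x v (C *: \prod_(r <- s) ('X - r%:P)).
Hypothesis P0_gt0 : 0 < C * \prod_(r <- s) (0 - r).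

Let pos := pos_counts hk hl a_gt0 a_decr IL JL TP P0_gt0.
Let neg := neg_counts hk hl a_gt0 a_decr IL JL TP P0_gt0.

Lemma sizes_bc : (k.*2.-1 <= size b)%N /\ (l.*2.-1 <= size c)%N.
Proof.
have := pos.1; have := neg.1; have := size_b_ge; have := size_c_ge.
by rewrite -/s'; lia.
Qed.

(** Interlacing puts [j] positive poles below [L i] and the parity chain puts [j] positive caustics
    there, boundary cases being counted on the appropriate side; together they fix the position [2j]
    in [b]. *)
Lemma segment_pos (i : 'I_(k + l)) (j : nat) : (i < k)%N -> j = (k.-1 - i)%N ->
  (nth 0%E (0%E :: b) j.*2 <= (L i)%:E)%E /\
  ((L i)%:E <= nth 0%E (0%E :: b) j.*2.+1)%E.
Proof.
move=> ik ji; have [i1 i2] := pos.2 i ik.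
(* The negative side takes at least [l - 1] of the at most [k + l - 1] finite caustics, which leaves
   at most [k] positive ones. *)
have {}i2 : (count_oo s (L i) <= k.-1 - i)%N.
  by apply: i2; have := neg.1; have := npos_sum; rewrite -/s'; lia.
have [/andP[L0 Li] Lm] := IL i; have [ei _] := E_pos a ik.
rewrite ei mul1r in L0 Li Lm.
have jE : (k - i.+1 = j)%N by lia.
have ikn : (i.+1 <= k <= k + l)%N by rewrite ik leq_addr.
apply: nth_bracket => //.
- by have := sizes_bc.1; lia.
- rewrite count_b -addnn ji; apply: leq_add; last first.
    rewrite (leq_trans _ i2) // /count_oo (count_finite_part (Q' := fun r => 0 < r < L i)) //.
    by rewrite andbC ltNge leey.
  rewrite -ji -jE -(count_enum_range ikn).
  apply: sub_count => m /=; rewrite !lte_fin E_gt0 => /andP[mk mL]; rewrite mk andbT.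
  rewrite ltnNge; apply/negP => mi; have := E_antitone a_decr mi.
  by rewrite (E_pos a ik).2; lra.
- rewrite count_b -addnn ji; apply: leq_add; last first.
    rewrite (leq_trans i1) // /count_oc (count_finite_part (Q' := fun r => 0 < r <= L i)) //.
    by rewrite andbC leNgt ltry.
  rewrite -ji -jE -(count_enum_range ikn).
  apply: sub_count => m /= /andP[im mk]; rewrite lte_fin lee_fin E_gt0 mk /=.
  have [em Em] := E_pos a mk; rewrite Em; apply: Lm => //.
  by have := a_decr im; rewrite Em (E_pos a ik).2.
Qed.

Lemma segment_neg (i : 'I_(k + l)) (j : nat) : (i = k + j :> nat)%N ->
  (nth 0%E (0%E :: c) j.*2.+1 <= (L i)%:E)%E /\
  ((L i)%:E <= nth 0%E (0%E :: c) j.*2)%E.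
Proof.
move=> ij; have ki : (k <= i)%N by rewrite ij leq_addr.
have ijE : (i - k = j)%N by rewrite ij addKn.
have jl : (j < l)%N by have := ltn_ord i; lia.
have [i1 i2] := neg.2 i ki; rewrite ijE -/s' in i1 i2.
have {}i2 : (count_oo s' (- L i) <= j)%N.
  by apply: i2; have := pos.1; have := npos_sum; rewrite -/s'; lia.
have [/andP[L0 Li] Lm] := IL i; have [ei _] := E_neg a ki.
rewrite ei mulN1r in L0 Li Lm.
have szc : (j.*2 < size c)%N by have := sizes_bc.2; lia.
have ikn : (k <= i <= k + l)%N by rewrite ki ltnW.
pose c' := [seq (- y)%E | y <- c].
have nthN n : (n < (size c).+1)%N -> nth 0%E (0%E :: c') n = (- nth 0%E (0%E :: c) n)%E.
  case: n => [|n] h; first by rewrite -[RHS]EFinN oppr0.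
  by rewrite /= (nth_map 0%E).
have [h1 h2] : (nth 0%E (0%E :: c') j.*2 <= (- L i)%:E)%E /\
  ((- L i)%:E <= nth 0%E (0%E :: c') j.*2.+1)%E.
  apply: nth_bracket => //; rewrite ?size_map //.
  - rewrite sorted_map; apply: sub_sorted c_sorted => y z /=.
    by rewrite /Order.ge /= leeN2.
  - rewrite count_map count_c -addnn; apply: leq_add; last first.
      rewrite (leq_trans _ i2) // /count_oo /s' count_map.
      rewrite (count_finite_part (Q' := preim (fun r => - r) (fun r => 0 < r < - L i))) //.
      by move=> r /=; rewrite lte_fin oppr_gt0.
    rewrite -ijE -(count_enum_range ikn).
    apply: sub_count => m /=; rewrite !lte_fin E_lt0 => /andP[mk mL]; rewrite mk /=.
    rewrite ltnNge; apply/negP => mi; have := E_antitone a_decr mi.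
    by rewrite (E_neg a ki).2; lra.
  - rewrite count_map count_c -addnn; apply: leq_add; last first.
      rewrite (leq_trans i1) // /count_oc /s' count_map.
      rewrite (count_finite_part (Q' := preim (fun r => - r) (fun r => 0 < r <= - L i))) //.
      by move=> r /=; rewrite lte_fin oppr_gt0.
    rewrite -ijE -(count_enum_range ikn).
    apply: sub_count => m /= /andP[km im]; rewrite lte_fin lee_fin E_lt0 km /=.
    have [em Em] := E_neg a km; rewrite Em opprK; apply: Lm => //.
    by have := a_decr im; rewrite Em (E_neg a ki).2 ltrN2.
by move: h1 h2; rewrite !nthN ?ltnS ?(ltnW szc) // EFinN !leeN2.
Qed.

End Line.

End Segments.

(** * Critical points and monotonicity *)

Lemma near_dist (R : realType) (t : R) (P : R -> Prop) :
  (\forall s \near t, P s) <->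
  exists2 e, 0 < e & forall s, `|s - t| < e -> P s.
Proof.
split=> [/nbhs_ballP[e e0 h]|[e e0 h]].
  by exists e => // s st; apply: h; rewrite /ball /= distrC.
by apply/nbhs_ballP; exists e => // s; rewrite /ball /= distrC; exact: h.
Qed.

Lemma quadratic_sign (R : realType) (A B C : R) : 0 < A ->
  exists2 d, 0 < d & forall h, `|h| < d -> 0 < A + B * h + C * h ^+ 2.
Proof.
move=> A0; pose M := `|B| + `|C| + 1.
have M0 : 0 < M by rewrite /M; have := normr_ge0 B; have := normr_ge0 C; lra.
exists (Num.min 1 (A / M)); first by rewrite lt_min ltr01 divr_gt0.
move=> h; rewrite lt_min => /andP[h1 h2].
have hA : `|h| * M < A by rewrite -ltr_pdivlMr.
have hB : `|B * h| <= `|h| * `|B| by rewrite normrM mulrC.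
have hC : `|C * h ^+ 2| <= `|h| * `|C|.
  rewrite normrM normrX mulrC ler_wpM2r // expr2.
  by rewrite -[leRHS]mulr1 ler_wpM2l // ltW.
have := ler_normlP _ _ hB; have := ler_normlP _ _ hC => -[c1 c2] [b1 b2].
have : `|h| * M = `|h| * `|B| + `|h| * `|C| + `|h| by rewrite /M; ring.
by have := normr_ge0 h; lra.
Qed.

Lemma is_derive0_small (R : realType) (f : R -> R) (t e : R) : 0 < e ->
  is_derive t (1 : R) f 0 ->
  exists2 d, 0 < d & forall h, `|h| < d -> `|f (t + h) - f t| <= e * `|h|.
Proof.
move=> e0 [df Df]; have : (fun h =>
    h^-1 *: ((f \o shift t) (h *: (1 : R)) - f t)) @ 0^' --> 'D_1 f t.
  exact: df.
rewrite Df => /cvgrPdist_lt/(_ e e0); rewrite near_withinE => /near_dist[d d0 h].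
exists d => // s sd; have [->|s0] := eqVneq s 0; first by rewrite addr0 subrr normr0 mulr0.
have := h s; rewrite subr0 => /(_ sd s0); rewrite sub0r normrN /=.
rewrite -[s *: 1]/(s * 1) mulr1 -[s^-1 *: _]/(s^-1 * _) normrM normfV.
rewrite mulrC ltr_pdivrMr ?normr_gt0 // => /ltW.
by rewrite [s + t]addrC.
Qed.

(* [B1] and [B2] are the one-sided slopes at [t] of a quadratic motion which
   is compared with [f] by the positive factors [c]. *)
Lemma critical_slope (R : realType) (f : R -> R) (t d sg Bd B1 B2 V1 V2 : R) :
  0 < d -> sg = 1 \/ sg = -1 ->
  (forall h, 0 <= h < d -> exists c, 0 < c <= Bd /\
     B1 * h + V1 * h ^+ 2 = sg * (f (t + h) - f t) * c) ->
  (forall h, 0 <= h < d -> exists c, 0 < c <= Bd /\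
     B2 * - h + V2 * h ^+ 2 = sg * (f (t - h) - f t) * c) ->
  B1 = B2 -> critical_time f t -> B1 = 0.
Proof.
move=> d0 sg1 right left BB; subst B2; apply: contraPeq => B0 [ext|der].
  (* A nonzero common slope gives the increments of [f] at [t + h] and [t - h] opposite signs for
     small [h], which no extremum allows. *)
  suff [e e0 h] : exists2 e, 0 < e & forall h, 0 < h < e ->
      (f (t + h) - f t) * (f (t - h) - f t) < 0.
    have key (Q : R -> Prop) : (\forall s \near t, Q s) ->
        exists2 s, 0 < s < e & Q (t + s) /\ Q (t - s).
      move=> /near_dist[d' d'0 hQ].
      have m0 : 0 < Num.min e d' by rewrite lt_min e0.
      exists (Num.min e d' / 2).
        by have : Num.min e d' <= e by [rewrite ge_min lexx]; lra.
      have hd : Num.min e d' / 2 < d'.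
        by have : Num.min e d' <= d' by [rewrite ge_min lexx orbT]; lra.
      have hp : 0 < Num.min e d' / 2 by lra.
      by split; apply: hQ; rewrite addrAC subrr add0r ?normrN gtr0_norm.
    case: ext => /key[s se [h1 h2]]; have := h s se; apply/negP; rewrite -leNgt.
      by rewrite mulr_le0 // subr_le0.
    by rewrite mulr_ge0 // subr_ge0.
  have B20 : 0 < B1 ^+ 2 by rewrite lt_neqAle sqr_ge0 eq_sym expf_neq0.
  have [e1 e10 h1] := quadratic_sign (B1 * V1) 0 B20.
  have [e2 e20 h2] := quadratic_sign (- (B1 * V2)) 0 B20.
  exists (Num.min d (Num.min e1 e2)); first by rewrite !lt_min d0 e10 e20.
  move=> h; rewrite !lt_min => /and4P[h0 hd he1 he2].
  have hn : `|h| = h by rewrite gtr0_norm.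
  have {}h1 := h1 h; have {}h2 := h2 h; rewrite hn in h1 h2.
  have {}h1 := h1 he1; have {}h2 := h2 he2.
  have h0d : 0 <= h < d by rewrite ltW.
  have [c1 [/andP[c10 _] r]] := right h h0d.
  have [c2 [/andP[c20 _] l]] := left h h0d.
  have r' : 0 < B1 * (sg * (f (t + h) - f t) * c1).
    rewrite -r; have -> : B1 * (B1 * h + V1 * h ^+ 2) =
      h * (B1 ^+ 2 + B1 * V1 * h + 0 * h ^+ 2) by ring.
    exact: mulr_gt0.
  have l' : 0 < - B1 * (sg * (f (t - h) - f t) * c2).
    rewrite -l; have -> : - B1 * (B1 * - h + V2 * h ^+ 2) =
      h * (B1 ^+ 2 + - (B1 * V2) * h + 0 * h ^+ 2) by ring.
    exact: mulr_gt0.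
  have : 0 < B1 ^+ 2 * (c1 * c2) * - ((f (t + h) - f t) * (f (t - h) - f t)).
    have -> : B1 ^+ 2 * (c1 * c2) * - ((f (t + h) - f t) * (f (t - h) - f t)) =
       B1 * (sg * (f (t + h) - f t) * c1) * (- B1 * (sg * (f (t - h) - f t) * c2)).
      by case: sg1 => ->; ring.
    exact: mulr_gt0.
  have p0 : 0 < B1 ^+ 2 * (c1 * c2) by apply: mulr_gt0 => //; exact: mulr_gt0.
  by rewrite pmulr_rgt0 // oppr_gt0.
(* For a vanishing derivative the right side suffices. The slope [|B1| / (2 * Bd)] allowed to [f]
   becomes [|B1| / 2] after the factor [c <= Bd], and [d2] keeps the quadratic term below
   [|B1| / 4], which contradicts [B1 != 0]. *)
have Bd0 : 0 < Bd.
  have [|c [/andP[c0 cB] _]] := right 0; first by rewrite lexx.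
  exact: lt_le_trans cB.
have nB : 0 < `|B1| by rewrite normr_gt0.
have e0 : 0 < `|B1| / (2 * Bd) by rewrite divr_gt0 // mulr_gt0.
have [d1 d10 small] := is_derive0_small e0 der.
pose d2 := `|B1| / (4 * (`|V1| + 1)).
have V0 : 0 < `|V1| + 1 by have := normr_ge0 V1; lra.
have d20 : 0 < d2 by rewrite divr_gt0 // mulr_gt0.
pose h := Num.min (Num.min d d1) d2 / 2.
have m0 : 0 < Num.min (Num.min d d1) d2 by rewrite !lt_min d0 d10 d20.
have h0 : 0 < h by rewrite /h; lra.
have hm : h < Num.min (Num.min d d1) d2 by rewrite /h; lra.
move: hm; rewrite !lt_min => /andP[/andP[hd hd1] hd2].
have [|c [/andP[c0 cB] e]] := right h; first by rewrite hd ltW.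
have := small h; rewrite gtr0_norm // => /(_ hd1) sm.
have : `|B1 * h + V1 * h ^+ 2| <= `|B1| / (2 * Bd) * h * Bd.
  rewrite e !normrM; have -> : `|sg| = 1 by case: sg1 => ->; rewrite ?normrN normr1.
  by rewrite mul1r (gtr0_norm c0) ler_pM // ltW.
have -> : `|B1| / (2 * Bd) * h * Bd = `|B1| / 2 * h by field; rewrite gt_eqF.
have -> : B1 * h + V1 * h ^+ 2 = (B1 + V1 * h) * h by ring.
rewrite normrM (gtr0_norm h0) ler_pM2r // => le.
have : `|B1| <= `|B1 + V1 * h| + `|V1 * h|.
  by rewrite -{1}[B1](addrK (V1 * h)) ler_normB.
have : `|V1 * h| <= `|B1| / 4.
  rewrite normrM (gtr0_norm h0); apply: (@le_trans _ _ ((`|V1| + 1) * d2)).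
    by apply: ler_pM; rewrite ?(ltW h0) ?(ltW hd2) //; lra.
  by rewrite /d2 le_eqVlt; apply/orP; left; apply/eqP; field; rewrite gt_eqF.
lra.
Qed.

(** Only levels strictly inside the range can be tested. When [g t] is an end of the range, the
    bound on the range replaces the missing comparison. *)
Lemma continuous_of_comparison (R : realType) (g : R -> R) (t p q : R) :
  p < q -> (\forall s \near t, p <= g s <= q) ->
  (forall w, p < w < q -> w < g t -> \forall s \near t, w < g s) ->
  (forall w, p < w < q -> g t < w -> \forall s \near t, g s < w) ->
  {for t, continuous g}.
Proof.
move=> pq rng lo hi; have /andP[pt tq] : p <= g t <= q by apply: nbhs_singleton rng.
have lower e : 0 < e -> \forall s \near t, g t - e < g s.
  move=> e0; have [gp|gp] := leP (g t) p.
    by apply: filterS rng => s /andP[h _]; lra.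
  pose w := Num.max ((p + g t) / 2) (g t - e).
  have wg : w < g t by rewrite gt_max; apply/andP; split; lra.
  have pw : p < w by rewrite lt_max; apply/orP; left; lra.
  have we : g t - e <= w by rewrite le_max lexx orbT.
  have := lo w; rewrite pw (lt_le_trans wg tq) => /(_ isT wg).
  by apply: filterS => s; exact: le_lt_trans.
have upper e : 0 < e -> \forall s \near t, g s < g t + e.
  move=> e0; have [gp|gp] := leP q (g t).
    by apply: filterS rng => s /andP[_ h]; lra.
  pose w := Num.min ((q + g t) / 2) (g t + e).
  have wg : g t < w by rewrite lt_min; apply/andP; split; lra.
  have pw : w < q by rewrite gt_min; apply/orP; left; lra.
  have we : w <= g t + e by rewrite ge_min lexx orbT.
  have := hi w; rewrite pw (le_lt_trans pt wg) => /(_ isT wg).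
  by apply: filterS => s h; exact: lt_le_trans we.
apply/cvgrPdist_lt => e e0; have := lower e e0; have := upper e e0.
apply: filterS2 => s h1 h2; rewrite ltr_norml; apply/andP; split; lra.
Qed.

(** Equal values at [u] and [w] would force the maximum and the minimum over [[u, w]] to the ends,
    making [f] constant there and the midpoint an extremum. So [f] is injective, and continuity
    makes it monotone. *)
Lemma strictly_monotone_no_extremum (R : realType) (f : R -> R) (s t : R) :
  s < t -> {in `[s, t], continuous f} ->
  (forall u, s < u < t -> ~ local_extremum f u) ->
  strictly_monotone_on f s t.
Proof.
move=> st fc noext.
have sub u w : s <= u -> w <= t -> u < w -> {within `[u, w], continuous f}.
  move=> su wt uw; apply: continuous_in_subspaceT => y /[!inE] /=.
  rewrite in_itv /= => /andP[uy yw]; apply: fc.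
  by rewrite in_itv /= (le_trans su) // (le_trans yw).
have interior u w y (Q : R -> Prop) : u < y < w -> (forall z, u <= z <= w -> Q z) ->
    \forall z \near y, Q z.
  move=> /andP[uy yw] hQ; apply/near_dist.
  exists (Num.min (y - u) (w - y)); first by rewrite lt_min !subr_gt0 uy.
  move=> z; rewrite lt_min !ltr_norml => /andP[/andP[z1 z2] /andP[z3 z4]].
  by apply: hQ; apply/andP; split; lra.
have inj u w : s <= u -> w <= t -> u < w -> f u != f w.
  move=> su wt uw; apply/eqP => fuw.
  have [m m_in mmax] := EVT_max (ltW uw) (sub u w su wt uw).
  have [m' m'_in m'min] := EVT_min (ltW uw) (sub u w su wt uw).
  rewrite in_itv /= in m_in; rewrite in_itv /= in m'_in.
  have maxP z : u <= z <= w -> f z <= f m by move=> h; apply: mmax; rewrite in_itv.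
  have minP z : u <= z <= w -> f m' <= f z by move=> h; apply: m'min; rewrite in_itv.
  have inside z : u < z < w -> s < z < t.
    by move=> /andP[h1 h2]; apply/andP; split; lra.
  have fm : f m = f u.
    have [h|] := boolP (u < m < w).
      by case: (noext m (inside _ h)); left; exact: interior h maxP.
    rewrite negb_and -!leNgt => h; have /andP[um mw] := m_in.
    by case/orP: h => h; [congr f; lra|rewrite fuw; congr f; lra].
  have fm' : f m' = f u.
    have [h|] := boolP (u < m' < w).
      by case: (noext m' (inside _ h)); right; exact: interior h minP.
    rewrite negb_and -!leNgt => h; have /andP[um mw] := m'_in.
    by case/orP: h => h; [congr f; lra|rewrite fuw; congr f; lra].
  have mid : u < (u + w) / 2 < w by apply/andP; split; lra.
  have midle : u <= (u + w) / 2 <= w by case/andP: mid => /ltW -> /ltW ->.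
  case: (noext _ (inside _ mid)); left; apply: (interior _ _ _ _ mid) => z hz.
  by rewrite (le_trans (maxP z hz)) // fm -fm' minP.
have fI : {in `[s, t] &, injective f}.
  move=> u w; rewrite !in_itv /= => /andP[su ut] /andP[sw wt] fuw.
  case: (ltgtP u w) => // h; first by have := inj _ _ su wt h; rewrite fuw eqxx.
  by have := inj _ _ sw ut h; rewrite fuw eqxx.
have [mono|mono] := itv_continuous_inj_mono (sub _ _ (lexx s) (lexx t) st) fI; [left|right].
  move=> u w su uw wt; apply: mono => //; rewrite in_itv /=.
    by rewrite su; lra.
  by rewrite wt andbT; lra.
move=> u w su uw wt; apply: mono => //; rewrite in_itv /=.
  by rewrite wt andbT; lra.
by rewrite su; lra.
Qed.

(** * Reflections *)

Section Reflection.
Variables (R : realType) (k l : nat) (a : 'I_(k + l) -> R).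
Hypothesis hk : (1 <= k)%N.
Hypothesis hl : (1 <= l)%N.
Hypothesis a_gt0 : forall i, 0 < a i.
Hypothesis a_decr : forall i j : 'I_(k + l), (i < j)%N ->
  eps R j * a j < eps R i * a i.

Local Notation ep := (@eps R k l).
Local Notation E i := (eps R i * a i).

Lemma regular0 : regular a 0.
Proof. by move=> i; rewrite mulr0 subr0 gt_eqF. Qed.

(* The vector [eps_i x_i / (a_i - eps_i mu)], pseudo-normal to the confocal
   quadric [Q_mu] at [x], is tangent to the ellipsoid at [x]. *)
Lemma confocal_orthogonality mu x : mu != 0 -> regular a mu ->
  qform a 0 x x = 1 -> qform a mu x x = 1 ->
  tangent_hyperplane a x (\row_i (eps R i * x 0 i / (a i - eps R i * mu))).
Proof.
move=> mu0 reg q0 qmu; rewrite /tangent_hyperplane /=.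
(* The equations of the two quadrics are subtracted: [1 / (a_i - eps_i mu) - 1 / a_i] equals
   [eps_i mu / (a_i (a_i - eps_i mu))]. *)
apply: (mulfI mu0); rewrite mulr0 -[RHS](subrr 1) -{1}qmu -q0 /qform -sumrB.
rewrite mulr_sumr; apply: eq_bigr => i _; rewrite mxE mulr0 subr0.
have := reg i; have := a_gt0 i.
by case: (eps_sign R i) => ->; rewrite ?mul1r ?mulN1r ?opprK => h1 h2; field;
  rewrite ?h2 gt_eqF.
Qed.

(** The velocities differ by twice the normal component [n], and [qform a mu x n] is the
    pseudo-scalar product of [n] with the tangent vector of [confocal_orthogonality]. *)
Lemma reflection_preserves_qform mu x v v' : mu != 0 -> regular a mu ->
  qform a 0 x x = 1 -> qform a mu x x = 1 ->
  reflects (tangent_hyperplane a x) v v' -> qform a mu x v = qform a mu x v'.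
Proof.
move=> mu0 reg q0 qmu [u [n [_ orth -> ->]]].
suff h : qform a mu x n = 0.
  by rewrite -scaleN1r !qformDr qformZr h mulr0.
rewrite -(orth _ (confocal_orthogonality mu0 reg q0 qmu)).
apply: eq_bigr => i _; rewrite mxE; set D := _ - _.
transitivity (eps R i * eps R i * (x 0 i * n 0 i / D)); last by ring.
by rewrite eps_sqr mul1r.
Qed.

(** The sum is the pseudo-norm of the normal [w]. Were it nonzero, [w] and the hyperplane would span
    the space, and [n], orthogonal to both, would vanish by nondegeneracy. *)
Lemma singular_sum x : qform a 0 x x = 1 ->
  singular_hyperplane (tangent_hyperplane a x) ->
  \sum_i eps R i * x 0 i ^+ 2 / a i ^+ 2 = 0.
Proof.
move=> q0 [n [n0 Hn orth]].
pose w : 'rV[R]_(k + l) := \row_i (eps R i * x 0 i / a i).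
have wE u : pe_dot u w = qform a 0 x u.
  apply: eq_bigr => i _; rewrite mxE mulr0 subr0.
  by case: (eps_sign R i) => ->; ring.
have -> : \sum_i eps R i * x 0 i ^+ 2 / a i ^+ 2 = qform a 0 x w.
  apply: eq_bigr => i _; rewrite mxE mulr0 subr0.
  by have := a_gt0 i => ai; field; rewrite gt_eqF.
apply/eqP/negPn/negP => s0; move/eqP: n0; apply.
have dotDr y z c : pe_dot n (y + c *: z) = pe_dot n y + c * pe_dot n z.
  rewrite /pe_dot mulr_sumr -big_split; apply: eq_bigr => i _ /=.
  by rewrite !mxE; ring.
have n_perp u : pe_dot n u = 0.
  have := orth (u + (- (qform a 0 x u / qform a 0 x w)) *: w).
  rewrite dotDr wE [X in _ + _ * X]Hn mulr0 addr0; apply.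
  by rewrite /tangent_hyperplane /= qformDr qformZr; field.
apply/rowP => i; rewrite mxE; have := n_perp (delta_mx 0 i).
rewrite /pe_dot (bigD1 i) //= big1 ?addr0 => [|j ji]; last first.
  by rewrite mxE /= (negPf ji) mulr0.
rewrite mxE !eqxx mulr1 => /eqP; rewrite mulf_eq0 => /orP[|/eqP //].
by case: (eps_sign R i) => ->; rewrite ?oppr_eq0 oner_eq0.
Qed.

(* At a singular point [0] is a double root of the Jacobi polynomial, hence
   the two coordinates adjacent to [0] vanish. *)
Lemma singular_coordinate_eq0 x L (i : 'I_(k + l)) :
  qform a 0 x x = 1 -> singular_hyperplane (tangent_hyperplane a x) ->
  interlaced a L -> jacobi_factors a x L ->
  (forall m, eps R m = eps R i -> a i <= a m) -> L i = 0.
Proof.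
move=> q0 sing IL JL imin; have S0 := singular_sum q0 sing.
have [/andP[L1 L2] _] := IL i; apply/eqP/negPn/negP => Li0.
have L3 : 0 < eps R i * L i.
  rewrite lt_neqAle L1 eq_sym mulf_neq0 //.
  by case: (eps_sign R i) => ->; rewrite ?oppr_eq0 oner_neq0.
(* A point strictly between 0 and the supposedly nonzero coordinate: [gap_sign] makes
   [1 - qform a mu x x] positive there. *)
pose mu := L i / 2.
have epmu : eps R i * mu = eps R i * L i / 2 by rewrite mulrA.
have gap : open_gap a i mu.
  split; first by rewrite epmu; apply/andP; split; lra.
  by move=> m /imin h1 h2; move: h1; rewrite leNgt h2.
have [B /(_ x L IL JL)[c [/andP[c0 _] FE]]] := gap_sign a_gt0 a_decr gap.
have : 0 < 1 - qform a mu x x.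
  by rewrite FE mulr_gt0 // mulrBr epmu; lra.
rewrite subr_gt0 ltNge => /negP; apply.
have dpos j : 0 < a j - eps R j * mu.
  have [ej|ej] : eps R j = eps R i \/ eps R j = - eps R i.
  - by case: (eps_sign R j) => ->; case: (eps_sign R i) => ->;
      rewrite ?opprK; [left|right|right|left].
  - by have := imin j ej; rewrite ej epmu; lra.
  - by have := a_gt0 j; rewrite ej mulNr epmu; lra.
(* Expansion of [1 / (a_j - eps_j mu)] at 0 to first order with exact remainder. The linear term
   vanishes by singularity and the remainder is nonnegative, so the form is at least 1. *)
have -> : qform a mu x x = qform a 0 x x +
    mu * (\sum_i eps R i * x 0 i ^+ 2 / a i ^+ 2) +
    \sum_i mu ^+ 2 * (x 0 i ^+ 2 / (a i ^+ 2 * (a i - eps R i * mu))).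
  rewrite mulr_sumr -!big_split; apply: eq_bigr => j _ /=.
  rewrite mulr0 subr0; have := a_gt0 j; have := dpos j.
  case: (eps_sign R j) => -> h1 h2; field; rewrite ?(gt_eqF h2) /=.
    by rewrite gt_eqF //; lra.
  by rewrite gt_eqF //; lra.
rewrite q0 S0 mulr0 addr0 lerDl; apply: sumr_ge0 => j _.
by rewrite mulr_ge0 ?sqr_ge0 // divr_ge0 ?sqr_ge0 // mulr_ge0 ?sqr_ge0 ?ltW.
Qed.

Lemma gap_interval (i : 'I_(k + l)) : exists p, [/\ 0 <= p < a i,
  (forall mu, open_gap a i mu <-> p < eps R i * mu < a i) &
  (forall L, interlaced a L -> p <= eps R i * L i)].
Proof.
(* The modulus of the next pole of the same sign towards 0; the base value 0 serves the gap adjacent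
   to 0. *)
exists (\big[Num.max/0]_(m | (eps R m == eps R i) && (a m < a i)) a m).
split=> [|mu|L IL].
- apply/andP; split; first exact: bigmax_ge_id.
  by apply: bigmax_lt => // m /andP[].
- split=> [[/andP[m1 m2] h]|/andP[h m2]].
    rewrite m2 andbT; apply: bigmax_lt => // m /andP[/eqP]; exact: h.
  split; first by rewrite m2 andbT; apply: le_lt_trans h; exact: bigmax_ge_id.
  move=> m em ami; apply: le_lt_trans h.
  by apply: le_bigmax_cond; rewrite em eqxx.
- have [/andP[L1 _] h] := IL i; apply: bigmax_le => // m /andP[/eqP]; exact: h.
Qed.

End Reflection.

(** * Coordinates along a trajectory *)

Section Trajectory.
Variables (R : realType) (k l : nat) (a : 'I_(k + l) -> R).
Hypothesis hk : (1 <= k)%N.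
Hypothesis hl : (1 <= l)%N.
Hypothesis a_gt0 : forall i, 0 < a i.
Hypothesis a_decr : forall i j : 'I_(k + l), (i < j)%N ->
  eps R j * a j < eps R i * a i.
Variables (tau : int -> R) (v : int -> 'rV[R]_(k + l)) (pos : R -> 'rV[R]_(k + l)).
Hypothesis T : billiard_trajectory a tau v pos.
Variable alpha : (k + l).-1.-tuple (\bar R).
Hypothesis caustics : trajectory_caustics a tau v pos alpha.
Hypothesis alpha_neq0 : 0%E \notin alpha.

Local Notation ep := (@eps R k l).
Local Notation E i := (eps R i * a i).
Local Notation s := (finite_part alpha).

Lemma lifetime_cases t : lifetime tau t ->
  (exists n, t = tau n) \/ (exists n, tau n < t < tau (n + 1)).
Proof.
move=> [n /andP[]]; rewrite le_eqVlt => /orP[/eqP <-|h1]; first by left; exists n.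
rewrite le_eqVlt => /orP[/eqP ->|h2]; first by left; exists (n + 1).
by right; exists n; rewrite h1.
Qed.

Lemma lifetime_inside t : lifetime tau t -> qform a 0 (pos t) (pos t) <= 1.
Proof.
move=> /lifetime_cases[[n ->]|[n nt]]; first by rewrite (on_ellipsoid T).
exact/ltW/(inside_ellipsoid T nt).
Qed.

Lemma mem_finite_part r : (r \in s) = (r%:E \in alpha).
Proof.
have [alphaN _] := caustics 0; apply/mapP/idP => [[[x| |]]|h].
- by rewrite mem_filter => /andP[_ h] ->.
- by rewrite mem_filter.
- by rewrite mem_filter => /andP[_ h]; rewrite h in alphaN.
- by exists r%:E => //; rewrite mem_filter.
Qed.

(** Within the ellipsoid both terms of the tangency form at 0 are nonnegative; strictness holds
    because 0 is not a caustic. *)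
Lemma segment_tangency n t : tau n <= t <= tau (n + 1) -> exists C,
  tangency_poly a (pos t) (v n) (C *: \prod_(r <- s) ('X - r%:P)) /\
  0 < C * \prod_(r <- s) (0 - r).
Proof.
move=> nt; have [_ [P [TP [P0 PE]]]] := caustics n.
have TP' : tangency_poly a (pos t) (v n) P.
  by move=> lam reg; rewrite (uniform_motion T nt) tangency_form_line TP.
exists (lead_coef P); rewrite -/s in PE; rewrite -PE; split=> //.
have -> : lead_coef P * \prod_(r <- s) (0 - r) = P.[0].
  rewrite [in RHS]PE hornerZ horner_prod; congr (_ * _).
  by apply: eq_bigr => r _; rewrite hornerXsubC.
have x_in : qform a 0 (pos t) (pos t) <= 1 by apply: lifetime_inside; exists n.
rewrite lt_neqAle; apply/andP; split.
  rewrite eq_sym [in X in X.[0]]PE hornerZ mulf_neq0 ?lead_coef_eq0 //.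
  rewrite horner_prod prodf_seq_neq0; apply/allP => r; rewrite mem_finite_part => r_in.
  rewrite hornerXsubC sub0r oppr_eq0 /=.
  by apply/eqP => r0; move: r_in; rewrite r0 (negPf alpha_neq0).
have := TP' 0 (regular0 a_gt0); rewrite /tangency_form => h.
have pi_gt0 : 0 < \prod_i (a i - ep i * 0).
  by apply: prodr_gt0 => i _; rewrite mulr0 subr0.
rewrite -(divfK (lt0r_neq0 pi_gt0) P.[0]) -h mulr_ge0 ?(ltW pi_gt0) //.
have vv : 0 <= qform a 0 (v n) (v n).
  apply: sumr_ge0 => i _; rewrite mulr0 subr0 -expr2.
  by rewrite divr_ge0 ?sqr_ge0 // ltW.
by rewrite addr_ge0 ?sqr_ge0 // -mulrN opprB mulr_ge0 // subr_ge0.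
Qed.

(** The indices [n1] and [n2] are those of the velocities just before and just after [t]; they
    differ only at a reflection. *)
Lemma local_motion t : lifetime tau t -> exists n1 n2 d,
  [/\ 0 < d, tau n2 <= t <= tau (n2 + 1),
   forall h, 0 <= h < d -> lifetime tau (t + h) /\ pos (t + h) = pos t + h *: v n2,
   forall h, 0 <= h < d -> lifetime tau (t - h) /\ pos (t - h) = pos t + (- h) *: v n1 &
   n1 = n2 \/ (t = tau (n1 + 1) /\ n2 = n1 + 1)].
Proof.
have fwd n u h : tau n <= u <= tau (n + 1) -> tau n <= u + h <= tau (n + 1) ->
    lifetime tau (u + h) /\ pos (u + h) = pos u + h *: v n.
  move=> nu nuh; split; first by exists n.
  rewrite (uniform_motion T nu) (uniform_motion T nuh) -[RHS]addrA -scalerDl.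
  by congr (_ + _ *: _); ring.
have refl n : exists n1 n2 d,
    [/\ 0 < d, tau n2 <= tau n <= tau (n2 + 1),
     forall h, 0 <= h < d -> lifetime tau (tau n + h) /\
       pos (tau n + h) = pos (tau n) + h *: v n2,
     forall h, 0 <= h < d -> lifetime tau (tau n - h) /\
       pos (tau n - h) = pos (tau n) + (- h) *: v n1 &
     n1 = n2 \/ (tau n = tau (n1 + 1) /\ n2 = n1 + 1)].
  have h1 := tau_increasing T n; have := tau_increasing T (n - 1).
  rewrite subrK => h2.
  exists (n - 1), n, (Num.min (tau (n + 1) - tau n) (tau n - tau (n - 1))).
  split; first by rewrite lt_min !subr_gt0 h1.
  - by rewrite lexx ltW.
  - move=> h; rewrite lt_min => /and3P[h0 hd1 hd2].
    by apply: fwd; apply/andP; split; lra.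
  - move=> h; rewrite lt_min => /and3P[h0 hd1 hd2].
    by apply: fwd; rewrite subrK; apply/andP; split; lra.
  - by right; rewrite subrK.
move=> /lifetime_cases[[n ->]|[n /andP[h1 h2]]]; first exact: refl.
exists n, n, (Num.min (tau (n + 1) - t) (t - tau n)).
split; first by rewrite lt_min !subr_gt0 h1 h2.
- by rewrite !ltW.
- move=> h; rewrite lt_min => /and3P[h0 hd1 hd2].
  by apply: fwd; apply/andP; split; lra.
- move=> h; rewrite lt_min => /and3P[h0 hd1 hd2].
  by apply: fwd; apply/andP; split; lra.
- by left.
Qed.

Lemma qform_sign_near t mu sg : lifetime tau t ->
  0 < sg * (1 - qform a mu (pos t) (pos t)) ->
  \forall u \near t, lifetime tau u /\ 0 < sg * (1 - qform a mu (pos u) (pos u)).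
Proof.
move=> lt F0; have [n1 [n2 [d [d0 _ r lf _]]]] := local_motion lt.
pose x := pos t.
have side w h : sg * (1 - qform a mu (x + h *: w) (x + h *: w)) =
    sg * (1 - qform a mu x x) + (- (sg * (2 * qform a mu x w))) * h +
    (- (sg * qform a mu w w)) * h ^+ 2.
  by rewrite qform_line; ring.
have [d1 d10 h1] := quadratic_sign (- (sg * (2 * qform a mu x (v n1))))
  (- (sg * qform a mu (v n1) (v n1))) F0.
have [d2 d20 h2] := quadratic_sign (- (sg * (2 * qform a mu x (v n2))))
  (- (sg * qform a mu (v n2) (v n2))) F0.
apply/near_dist; exists (Num.min d (Num.min d1 d2)); first by rewrite !lt_min d0 d10.
move=> u; rewrite !lt_min => /and3P[ud ud1 ud2].
have [tu|ut] := leP t u.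
  have := r (u - t); rewrite subrKC subr_ge0 tu -(@ger0_norm _ (u - t)) ?subr_ge0 // ud.
  by rewrite ger0_norm ?subr_ge0 // => /(_ isT)[h ->]; rewrite side; split=> //; apply: h2.
have ut' : 0 <= t - u by rewrite subr_ge0 ltW.
have := lf (t - u); rewrite subKr ut' -{1}(ger0_norm ut') distrC ud opprB.
by move=> /(_ isT)[h ->]; rewrite side; split=> //; apply: h1.
Qed.

Variable L : R -> 'I_(k + l) -> R.
Hypothesis IL : forall t, lifetime tau t -> interlaced a (L t).
Hypothesis JL : forall t, lifetime tau t -> jacobi_factors a (pos t) (L t).

Lemma lifetime_near t : lifetime tau t -> \forall u \near t, lifetime tau u.
Proof.
move=> lt; have [n1 [n2 [d [d0 _ r lf _]]]] := local_motion lt.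
apply/near_dist; exists d => // u ud; have [tu|ut] := leP t u.
  have := r (u - t); rewrite subrKC subr_ge0 tu -(@ger0_norm _ (u - t)) ?subr_ge0 // ud.
  by case.
have ut' : 0 <= t - u by rewrite subr_ge0 ltW.
by have := lf (t - u); rewrite subKr ut' -(ger0_norm ut') distrC ud; case.
Qed.

(** The sign of [1 - qform a mu (pos t) (pos t)] tells on which side of a level [mu] of the gap the
    coordinate lies, and that sign persists near [t]. *)
Lemma coordinate_continuous i t : lifetime tau t ->
  {for t, continuous (fun u => L u i)}.
Proof.
move=> lt; have [p [/andP[p0 pa] gapP pL]] := gap_interval a_gt0 i.
pose g u := eps R i * L u i.
have gc : {for t, continuous g}.
  apply: (@continuous_of_comparison _ _ _ p (a i)) => //.
  - apply: filterS (lifetime_near lt) => u lu.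
    by rewrite /g (pL _ (IL lu)); have [/andP[_ ->] _] := IL lu i.
  - move=> w /andP[pw wa] wg; pose mu := eps R i * w.
    have emu : eps R i * mu = w by rewrite mulrA eps_sqr mul1r.
    have gap : open_gap a i mu by apply/gapP; rewrite emu pw.
    have [B hB] := gap_sign a_gt0 a_decr gap.
    have signF u c : eps R i * (L u i - mu) * c = (g u - w) * c.
      by rewrite mulrBr emu.
    have [c [/andP[c0 _] FE]] := hB _ _ (IL lt) (JL lt).
    have : 0 < 1 * (1 - qform a mu (pos t) (pos t)).
      by rewrite mul1r FE signF mulr_gt0 // subr_gt0.
    move=> /(qform_sign_near lt); apply: filterS => u [lu].
    have [c' [/andP[c'0 _] ->]] := hB _ _ (IL lu) (JL lu).
    by rewrite mul1r signF pmulr_lgt0 // subr_gt0.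
  - move=> w /andP[pw wa] wg; pose mu := eps R i * w.
    have emu : eps R i * mu = w by rewrite mulrA eps_sqr mul1r.
    have gap : open_gap a i mu by apply/gapP; rewrite emu pw.
    have [B hB] := gap_sign a_gt0 a_decr gap.
    have signF u c : eps R i * (L u i - mu) * c = (g u - w) * c.
      by rewrite mulrBr emu.
    have [c [/andP[c0 _] FE]] := hB _ _ (IL lt) (JL lt).
    have : 0 < -1 * (1 - qform a mu (pos t) (pos t)).
      by rewrite mulN1r FE signF -mulNr mulr_gt0 // opprB subr_gt0.
    move=> /(qform_sign_near lt); apply: filterS => u [lu].
    have [c' [/andP[c'0 _] ->]] := hB _ _ (IL lu) (JL lu).
    by rewrite mulN1r signF -mulNr pmulr_lgt0 // opprB subr_gt0.
have -> : (fun u => L u i) = (fun u => eps R i * g u).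
  by apply/funext => u; rewrite mulrA eps_sqr mul1r.
by apply: continuousM => //; exact: cst_continuous.
Qed.

Lemma coordinate_on_quadric i t : lifetime tau t -> regular a (L t i) ->
  qform a (L t i) (pos t) (pos t) = 1.
Proof.
move=> lt reg; have := jacobi_prod (JL lt) reg.
by rewrite (bigD1 i) //= subrr mul0r mul0r => /eqP; rewrite subr_eq0 eq_sym => /eqP.
Qed.

Lemma critical_tangent i t n1 n2 d : lifetime tau t -> 0 < d ->
  (forall h, 0 <= h < d -> lifetime tau (t + h) /\ pos (t + h) = pos t + h *: v n2) ->
  (forall h, 0 <= h < d -> lifetime tau (t - h) /\ pos (t - h) = pos t + (- h) *: v n1) ->
  regular a (L t i) -> L t i != 0 ->
  qform a (L t i) (pos t) (v n1) = qform a (L t i) (pos t) (v n2) ->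
  critical_time (fun u => L u i) t -> qform a (L t i) (pos t) (v n2) = 0.
Proof.
move=> lt d0 r lf reg L0 q12 crit; set mu := L t i in reg L0 q12 *.
have gap : open_gap a i mu by exact: (interlaced_open_gap (IL lt) reg L0).
have [B hB] := gap_sign a_gt0 a_decr gap.
have q1 : qform a mu (pos t) (pos t) = 1 by exact: coordinate_on_quadric.
suff : - (2 * qform a mu (pos t) (v n2)) = 0 by lra.
apply: (@critical_slope _ (fun u => L u i) t d (eps R i) B
  _ (- (2 * qform a mu (pos t) (v n1)))
  (- qform a mu (v n2) (v n2)) (- qform a mu (v n1) (v n1)) d0) => //.
- exact: eps_sign.
- move=> h hd; have [lh ph] := r h hd.
  have [c [cB FE]] := hB _ _ (IL lh) (JL lh); exists c; split=> //.
  by rewrite -FE ph qform_line q1; ring.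
- move=> h hd; have [lh ph] := lf h hd.
  have [c [cB FE]] := hB _ _ (IL lh) (JL lh); exists c; split=> //.
  by rewrite -FE ph qform_line q1; ring.
- by rewrite q12.
Qed.

Lemma critical_cases i t : lifetime tau t -> critical_time (fun u => L u i) t ->
  [\/ exists m, L t i = E m, L t i = 0,
      exists n, [/\ tau n <= t <= tau (n + 1), L t i \in s &
                    touches_at a (L t i) (pos t) (v n)] |
      exists n, t = tau n /\
        singular_hyperplane (tangent_hyperplane a (pos t))].
Proof.
move=> lt crit; have [[m hm]|nopole] := pselect (exists m, L t i = E m).
  by apply: Or41; exists m.
have reg : regular a (L t i).
  move=> m; apply/eqP => h; apply: nopole; exists m.
  by move: h; case: (eps_sign R m) => ->; lra.
have [->|L0] := eqVneq (L t i) 0; first exact: Or42.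
have [n1 [n2 [d [d0 nt r lf n12]]]] := local_motion lt.
have q1 := coordinate_on_quadric lt reg.
have finish : qform a (L t i) (pos t) (v n1) = qform a (L t i) (pos t) (v n2) ->
  exists n, [/\ tau n <= t <= tau (n + 1), L t i \in s &
                    touches_at a (L t i) (pos t) (v n)].
  move=> q12; have q0 := critical_tangent lt d0 r lf reg L0 q12 crit.
  exists n2; split=> //.
  (* Tangency at the point makes the tangency form vanish, so [L t i] is a root of the tangency
     polynomial, that is, a caustic. *)
  have [C [TP P0]] := segment_tangency nt; have := TP _ reg.
  rewrite /tangency_form q0 q1 subrr mulr0 subr0 expr0n /= => /esym/eqP.
  rewrite mulf_eq0 invr_eq0 (negPf (pole_prod_neq0 reg)) orbF hornerZ mulf_eq0.
  move=> /orP[/eqP C0|]; first by move: P0; rewrite C0 mul0r ltxx.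
  rewrite horner_prod prodf_seq_eq0 => /hasP[y ys /=].
  by rewrite hornerXsubC subr_eq0 => /eqP ->.
case: n12 => [e|[te e]]; first by apply: Or43; apply: finish; rewrite e.
have [sing nsing] := reflection T n1; rewrite -te -e in sing nsing.
have [S|S] := pselect (singular_hyperplane (tangent_hyperplane a (pos t))).
  by apply: Or44; exists (n1 + 1).
apply: Or43; apply: finish; apply: reflection_preserves_qform => //; last exact: nsing.
by rewrite te (on_ellipsoid T).
Qed.

Lemma coordinate_at_pole i m t : lifetime tau t -> L t i = E m -> pos t 0 m = 0.
Proof.
move=> lt LE; have := JL lt (E m).
rewrite (pole_prod_at_pole (pole_at_E a m)) (pole_sum_at_pole _ (pole_at_E a m)).
have -> : \prod_j (ep j * (L t j - E m)) = 0.
  by rewrite (bigD1 i) //= LE subrr mulr0 mul0r.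
rewrite sub0r => /eqP.
rewrite oppr_eq0 mulf_eq0 expf_eq0 /= => /orP[/eqP //|].
rewrite prodf_seq_eq0 => /hasP[j _ /andP[jm]].
rewrite pole_factor_diff mulf_eq0 => /orP[|].
  by case: (eps_sign R j) => ->; rewrite ?oppr_eq0 oner_eq0.
rewrite subr_eq0 => /eqP EE; case: (ltngtP j m) => [/a_decr|/a_decr|/val_inj h].
- by rewrite EE ltxx.
- by rewrite EE ltxx.
- by rewrite h eqxx in jm.
Qed.

Lemma coordinate_eq0_reflection i t : lifetime tau t -> L t i = 0 ->
  exists n, t = tau n.
Proof.
move=> lt Li; have [//|[n nt]] := lifetime_cases lt.
have := coordinate_on_quadric (i := i) lt; rewrite Li => /(_ (regular0 a_gt0)) q1.
by have := inside_ellipsoid T nt; rewrite q1 ltxx.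
Qed.

Lemma lifetime_convex u w t : lifetime tau u -> lifetime tau w ->
  u <= t <= w -> lifetime tau t.
Proof.
move=> [n /andP[nu _]] [m /andP[_ wm]] /andP[ut tw].
have mono j (N : nat) : tau j <= tau (j + N%:Z).
  elim: N => [|N IH]; first by rewrite addr0.
  apply: (le_trans IH); rewrite -addn1 PoszD addrA; apply/ltW/(tau_increasing T).
(* Reflection times may accumulate, so the segment containing [t] is found by induction over the
   finitely many reflections between two given ones. *)
have reach (N : nat) : tau n <= t <= tau (n + N%:Z) -> lifetime tau t.
  elim: N => [|N IH] /andP[nt tN].
    by exists n; rewrite nt (le_trans tN) // addr0 ltW // (tau_increasing T).
  have [h|h] := leP t (tau (n + N%:Z)); first by apply: IH; rewrite nt.
  by exists (n + N%:Z); rewrite (ltW h) -addrA -[N%:Z + 1]PoszD addn1.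
have nt := le_trans nu ut; have tm := le_trans tw wm.
have [nm|mn] := leP n (m + 1).
  have := reach (absz (m + 1 - n)%R); rewrite nt gez0_abs ?subr_ge0 //.
  by rewrite [n + _]addrC subrK tm; apply.
apply: (reach 0%N); rewrite nt addr0 (le_trans tm) //.
have := mono (m + 1) (absz (n - (m + 1))%R); rewrite gez0_abs ?subrKC //.
by rewrite subr_ge0 ltW.
Qed.

End Trajectory.

(** * Order of the segments and the list of critical values *)

Lemma mem_take_of_le_nth (A : eqType) (leT : rel A) (D : seq A) (x0 y : A) (n m : nat) :
  reflexive leT -> transitive leT -> antisymmetric leT -> sorted leT D ->
  y \in D -> leT y (nth x0 D n) -> (n < size D)%N -> (n < m)%N ->
  y \in take m D.
Proof.
move=> refl tr anti sD yD yn nD nm.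
suff [i im iy] : exists2 i, (i < minn m (size D))%N & nth x0 D i = y.
  by rewrite -iy -(nth_take x0 (n0 := m)) ?mem_nth ?size_take_min //; lia.
have iD : (index y D < size D)%N by rewrite index_mem.
have [h|h] := ltnP (index y D) m.
  by exists (index y D); rewrite ?nth_index // leq_min h.
(* If [y] first occurs beyond position [n] although it is at most the entry there, sortedness and
   antisymmetry make the two equal. *)
exists n; first by rewrite leq_min nm.
apply: anti; rewrite yn andbT -[X in leT _ X](nth_index x0 yD).
by apply: (sorted_leq_nth tr refl) => //; rewrite (leq_trans (ltnW nm)).
Qed.

(** The segments are listed outwards from 0, whereas the gaps follow decreasing poles; the two
    orders differ by reversing the first [k] indices. *)
Definition ascending_index (k l : nat) (j : 'I_(k + l)) : 'I_(k + l) :=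
  match fintype.split j with
  | inl i => lshift l (rev_ord i)
  | inr i => rshift k i
  end.

Lemma ascending_index_lshift (k l : nat) (i : 'I_k) :
  ascending_index (lshift l i) = lshift l (rev_ord i).
Proof. by rewrite /ascending_index (unsplitK (inl i)). Qed.

Lemma ascending_index_rshift (k l : nat) (i : 'I_l) :
  ascending_index (rshift k i) = rshift k i.
Proof. by rewrite /ascending_index (unsplitK (inr i)). Qed.

Lemma ascending_indexK (k l : nat) : involutive (@ascending_index k l).
Proof.
move=> j; rewrite -(splitK j); case: (fintype.split j) => i /=.
  by rewrite !ascending_index_lshift rev_ordK.
by rewrite !ascending_index_rshift.
Qed.

Section SegmentOrder.
Variables (R : realType) (k l : nat) (b c : seq (\bar R)).
Hypothesis b_sorted : sorted <=%O b.
Hypothesis b_gt0 : forall y, y \in b -> (0 < y)%E.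
Hypothesis c_sorted : sorted >=%O c.
Hypothesis c_lt0 : forall y, y \in c -> (y < 0)%E.
Hypothesis size_b : (k.*2.-1 <= size b)%N.
Hypothesis size_c : (l.*2.-1 <= size c)%N.

Let sorted_b0 : sorted <=%O (0%E :: b).
Proof. by rewrite /= path_min_sorted //; apply/allP => y /b_gt0 /ltW. Qed.

Let sorted_c0 : sorted >=%O (0%E :: c).
Proof. by rewrite /= path_min_sorted //; apply/allP => y /c_lt0 /ltW. Qed.

Let nth_b0 n m : (n <= m)%N -> (m < (size b).+1)%N ->
  (nth 0%E (0%E :: b) n <= nth 0%E (0%E :: b) m)%E.
Proof.
move=> nm ms; apply: (sorted_leq_nth le_trans le_refl 0%E sorted_b0) => //.
exact: leq_ltn_trans ms.
Qed.

Let nth_c0 n m : (n <= m)%N -> (m < (size c).+1)%N ->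
  (nth 0%E (0%E :: c) m <= nth 0%E (0%E :: c) n)%E.
Proof.
move=> nm ms; apply: (sorted_leq_nth ge_trans ge_refl 0%E sorted_c0) => //.
exact: leq_ltn_trans ms.
Qed.

Lemma segment_lshift (i : 'I_k) (r : R) : segment b c (lshift l i) r <->
  (nth 0%E (0%E :: b) i.*2 <= r%:E)%E /\
  (r%:E <= nth 0%E (0%E :: b) i.*2.+1)%E.
Proof. by rewrite /segment (unsplitK (inl i)). Qed.

Lemma segment_rshift (i : 'I_l) (r : R) : segment b c (rshift k i) r <->
  (nth 0%E (0%E :: c) i.*2.+1 <= r%:E)%E /\
  (r%:E <= nth 0%E (0%E :: c) i.*2)%E.
Proof. by rewrite /segment (unsplitK (inr i)). Qed.

Lemma segment_ge0 (i : 'I_k) (r : R) : segment b c (lshift l i) r -> 0 <= r.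
Proof.
move=> /segment_lshift[h _]; rewrite -lee_fin (le_trans _ h) //.
by apply: (@nth_b0 0) => //; have := ltn_ord i; lia.
Qed.

Lemma segment_le0 (i : 'I_l) (r : R) : segment b c (rshift k i) r -> r <= 0.
Proof.
move=> /segment_rshift[_ h]; rewrite -lee_fin (le_trans h) //.
by apply: (@nth_c0 0) => //; have := ltn_ord i; lia.
Qed.

(** One of two distinct segments lies weakly below the other, so they share at most a point. A
    coordinate confined to both is therefore constant. *)
Lemma segments_overlap (i j : 'I_(k + l)) (r r' : R) : i != j ->
  segment b c i r -> segment b c j r -> segment b c i r' -> segment b c j r' ->
  r = r'.
Proof.
wlog suff : i j / i != j ->
    (forall u w, segment b c i u -> segment b c j w -> u <= w) \/
    (forall u w, segment b c i u -> segment b c j w -> w <= u).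
  move=> h ij ri rj ri' rj'; apply/eqP; rewrite eq_le.
  by have [h'|h'] := h i j ij; rewrite ?(h' r r') ?(h' r' r).
rewrite -(splitK i) -(splitK j); case: (fintype.split i) => {}i;
  case: (fintype.split j) => {}j /= ij.
- have [ij'|ij'|ij'] := ltngtP i j; last by rewrite (val_inj ij') eqxx in ij.
    left=> u w /segment_lshift[_ h1] /segment_lshift[h2 _].
    rewrite -lee_fin (le_trans h1) // (le_trans _ h2) // nth_b0 //; have := ltn_ord j; lia.
  right=> u w /segment_lshift[h1 _] /segment_lshift[_ h2].
  rewrite -lee_fin (le_trans h2) // (le_trans _ h1) // nth_b0 //; have := ltn_ord i; lia.
- by right=> u w /segment_ge0 h1 /segment_le0 h2; exact: le_trans h1.
- by left=> u w /segment_le0 h1 /segment_ge0 h2; exact: le_trans h2.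
- have [ij'|ij'|ij'] := ltngtP i j; last by rewrite (val_inj ij') eqxx in ij.
    right=> u w /segment_rshift[h1 _] /segment_rshift[_ h2].
    rewrite -lee_fin (le_trans h2) // (le_trans _ h1) // nth_c0 //; have := ltn_ord j; lia.
  left=> u w /segment_rshift[_ h1] /segment_rshift[h2 _].
  rewrite -lee_fin (le_trans h1) // (le_trans _ h2) // nth_c0 //; have := ltn_ord i; lia.
Qed.

(** The outermost segments end at [b_(2k-1)] and [c_(2l-1)], so an entry inside a segment equals one
    of the retained entries even if it repeats further on. *)
Lemma segment_critical_value (j : 'I_(k + l)) (r : R) : segment b c j r ->
  r%:E \in b ++ c -> r%:E \in critical_values k l b c.
Proof.
rewrite -(splitK j) mem_cat /critical_values in_cons mem_cat.
case: (fintype.split j) => {}j /= seg; have jlt := ltn_ord j.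
  have r0 := segment_ge0 seg; have /segment_lshift[_ h] := seg.
  move=> /orP[rb|/c_lt0]; last by rewrite lte_fin ltNge r0.
  have : r%:E \in take k.*2 (0%E :: b).
    apply: (mem_take_of_le_nth (@le_refl _ _) (@le_trans _ _) (@le_anti _ _)
      sorted_b0 _ h); rewrite ?inE ?rb ?orbT //=; lia.
  have -> : k.*2 = (k.*2.-1).+1 by lia.
  by rewrite /= inE => /orP[->//|->]; rewrite orbT.
have r0 := segment_le0 seg; have /segment_rshift[h _] := seg.
move=> /orP[/b_gt0|rc]; first by rewrite lte_fin ltNge r0.
have : r%:E \in take l.*2 (0%E :: c).
  apply: (mem_take_of_le_nth (@ge_refl _ _) (@ge_trans _ _) (@ge_anti _ _)
    sorted_c0 _ h); rewrite ?inE ?rc ?orbT //=; lia.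
have -> : l.*2 = (l.*2.-1).+1 by lia.
by rewrite /= inE => /orP[->//|->]; rewrite !orbT.
Qed.

End SegmentOrder.

Lemma jacobi_coordinates_factors (R : realType) (k l : nat) (a : 'I_(k + l) -> R)
    (x : 'rV[R]_(k + l)) (L : 'I_(k + l) -> R) :
  jacobi_factors a x L ->
  jacobi_coordinates a x (fun j => L (ascending_index j)).
Proof.
move=> JL; pose kappa : R := \prod_(i < k + l) - eps R i.
have kappa0 : kappa != 0.
  apply/prodf_neq0 => i _.
  by case: (eps_sign R i) => ->; rewrite ?opprK ?oppr_eq0 oner_neq0.
have [szJ leadJ] := size_lead_jacobi a x.
split; first by rewrite -size_poly_gt0 szJ.
apply: poly_ext => mu; rewrite leadJ hornerZ horner_prod horner_jacobi JL.
rewrite big_map big_enum /= (reindex_inj (inv_inj (@ascending_indexK k l))) /=.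
rewrite [\prod_i - _](reindex_inj (inv_inj (@ascending_indexK k l))) -big_split /=.
by apply: eq_bigr => i _; rewrite hornerXsubC; ring.
Qed.

Theorem proposition5p2 (R : realType) (k l : nat) (hk : (1 <= k)%N)
    (hl : (1 <= l)%N) (a : 'I_(k + l) -> R)
    (a_gt0 : forall i, 0 < a i)
    (a_decr : forall i j : 'I_(k + l), (i < j)%N ->
       eps R j * a j < eps R i * a i)
    (tau : int -> R) (v : int -> 'rV[R]_(k + l)) (pos : R -> 'rV[R]_(k + l))
    (T : billiard_trajectory a tau v pos)
    (alpha : (k + l).-1.-tuple (\bar R))
    (caustics : trajectory_caustics a tau v pos alpha)
    (b c : seq (\bar R))
    (bc_multiset :
       perm_eq (b ++ c)
         ([seq (eps R i * a i)%:E | i <- enum 'I_(k + l)] ++ alpha))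
    (b_sorted : sorted <=%O b) (b_gt0 : forall y, y \in b -> (0 < y)%E)
    (c_sorted : sorted >=%O c) (c_lt0 : forall y, y \in c -> (y < 0)%E) :
  (k.*2.-1 <= size b)%N /\ (l.*2.-1 <= size c)%N /\
  exists lam : 'I_(k + l) -> R -> R,
    (forall t, lifetime tau t ->
       jacobi_coordinates a (pos t) (fun j => lam j t)) /\
    (* (PE3) *)
    ((forall j t, lifetime tau t -> segment b c j (lam j t)) /\
     (forall j i,
        (forall t, lifetime tau t -> segment b c i (lam j t)) ->
        i = j \/
        (forall s t, lifetime tau s -> lifetime tau t -> lam j s = lam j t))) /\
    (* (PE4) *)
    (forall j t, lifetime tau t -> local_extremum (lam j) t ->
       [\/ exists (n : int) (i : 'I_(k + l).-1),
             [/\ tau n <= t <= tau (n + 1),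
                 tnth alpha i = (lam j t)%:E &
                 touches_at a (lam j t) (pos t) (v n)],
           exists i, lam j t = eps R i * a i /\ pos t 0 i = 0 |
           exists n : int, t = tau n]) /\
    (* (PE5); the second alternative is the reversal v -> -v at a point where
       the tangent hyperplane contains its orthogonal vector: there every
       coordinate turns back, whatever its value, and only the two coordinates
       in [0, b_1] (index 0) and [c_1, 0] (index k) are bound to vanish *)
    ((forall j t, lifetime tau t -> critical_time (lam j) t ->
        (lam j t)%:E \in critical_values k l b c \/
        [/\ exists n : int, t = tau n,
            singular_hyperplane (tangent_hyperplane a (pos t)),
            nat_of_ord j != 0%N & nat_of_ord j != k]) /\
     (forall j s t, lifetime tau s -> lifetime tau t -> s < t ->
        (forall u, s < u < t -> ~ critical_time (lam j) u) ->
        strictly_monotone_on (lam j) s t)).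
Proof.
have alphaN : -oo%E \notin alpha by have [] := caustics 0.
have mem_bc y : (y \in [seq (eps R i * a i)%:E | i <- enum 'I_(k + l)] ++ alpha) =
    (y \in b ++ c) by rewrite (perm_mem bc_multiset).
have alpha_neq0 : 0%E \notin alpha.
  apply/negP => h; have := mem_bc 0%E; rewrite mem_cat h orbT => /esym.
  by rewrite mem_cat => /orP[/b_gt0|/c_lt0]; rewrite ltxx.
(* The roots are chosen separately at each time; assigning them to fixed gaps is what makes the
   choice continuous along the trajectory. *)
have /choice[L HL] : forall t, exists L, lifetime tau t ->
    interlaced a L /\ jacobi_factors a (pos t) L.
  move=> t; have [lt|nlt] := pselect (lifetime tau t); last by exists (fun=> 0).
  have [L HL] := jacobi_factorization hk a_gt0 a_decr (lifetime_inside T lt).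
  by exists L.
have IL t (lt : lifetime tau t) := (HL t lt).1.
have JL t (lt : lifetime tau t) := (HL t lt).2.
have [sb sc] : (k.*2.-1 <= size b)%N /\ (l.*2.-1 <= size c)%N.
  have t0 : tau 0 <= tau 0 <= tau (0 + 1) by rewrite lexx ltW // (tau_increasing T).
  have lt0 : lifetime tau (tau 0) by exists 0.
  have [C [TP P0]] := segment_tangency a_gt0 T caustics alpha_neq0 t0.
  exact: (sizes_bc hk hl a_gt0 a_decr alphaN bc_multiset b_sorted b_gt0
      c_sorted c_lt0 (IL _ lt0) (JL _ lt0) TP P0).
split=> //; split=> //; exists (fun j t => L t (ascending_index j)).
have seg j t : lifetime tau t -> segment b c j (L t (ascending_index j)).
  move=> lt; have [n nt] := lt.
  have [C [TP P0]] := segment_tangency a_gt0 T caustics alpha_neq0 nt.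
  rewrite -(splitK j); case: (fintype.split j) => i /=.
    rewrite ascending_index_lshift; apply/segment_lshift.
    apply: (segment_pos hk hl a_gt0 a_decr alphaN bc_multiset b_sorted b_gt0
      c_sorted c_lt0
      (IL _ lt) (JL _ lt) TP P0) => /=; have := ltn_ord i; lia.
  rewrite ascending_index_rshift; apply/segment_rshift.
  exact: (segment_neg hk hl a_gt0 a_decr alphaN bc_multiset b_sorted b_gt0
      c_sorted c_lt0
      (IL _ lt) (JL _ lt) TP P0).
have cases j := critical_cases a_gt0 a_decr T caustics alpha_neq0 IL JL
  (i := ascending_index j).
split; first by move=> t /JL; exact: jacobi_coordinates_factors.
split; first split=> // j i segi.
  have [->|ij] := eqVneq i j; [by left|right=> s t ls lt].
  exact: (segments_overlap b_sorted b_gt0 c_sorted c_lt0 sb sc ij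
    (segi _ ls) (seg _ _ ls) (segi _ lt) (seg _ _ lt)).
split.
  move=> j t lt ext; have crit : critical_time (fun u => L u (ascending_index j)) t by left.
  have [[m Lm]|L0|[n [nt Ls tch]]|[n [tn _]]] := cases j t lt crit.
  - apply: Or32; exists m; split=> //.
    exact: (coordinate_at_pole a_decr JL lt Lm).
  - by apply: Or33; exact: (coordinate_eq0_reflection a_gt0 T JL lt L0).
  - apply: Or31; exists n.
    move: Ls; rewrite (mem_finite_part caustics) => /tnthP[i ei].
    by exists i.
  - by apply: Or33; exists n.
split.
  move=> j t lt crit; have crit_in : (L t (ascending_index j))%:E \in b ++ c ->
      (L t (ascending_index j))%:E \in critical_values k l b c.
    exact: (segment_critical_value b_sorted b_gt0 c_sorted c_lt0 sb sc (seg j t lt)).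
  have [[m Lm]|L0|[n [nt Ls tch]]|[n [tn sing]]] := cases j t lt crit.
  - left; apply: crit_in; rewrite -mem_bc mem_cat; apply/orP; left.
    by apply/mapP; exists m; rewrite ?mem_enum // Lm.
  - by left; rewrite L0 in_cons eqxx.
  - left; apply: crit_in; rewrite -mem_bc mem_cat; apply/orP; right.
    by rewrite -(mem_finite_part caustics).
  have q0 : qform a 0 (pos t) (pos t) = 1 by rewrite tn (on_ellipsoid T).
  (* At a singular reflection only the coordinates whose pole is nearest to 0 on its side are known
     to vanish; under [ascending_index] these are [j = 0] and [j = k]. *)
  have zero : (forall m, eps R m = eps R (ascending_index j) ->
      a (ascending_index j) <= a m) ->
      (L t (ascending_index j))%:E \in critical_values k l b c.
    move=> jmin.
    rewrite (singular_coordinate_eq0 a_gt0 a_decr q0 sing (IL _ lt) (JL _ lt) jmin).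
    by rewrite in_cons eqxx.
  have [j0|j0] := eqVneq (nat_of_ord j) 0%N.
    left; apply: zero => m; have ji : (ascending_index j = k.-1 :> nat)%N.
      have -> : j = lshift l (Ordinal hk) by apply/val_inj; rewrite /= j0.
      by rewrite ascending_index_lshift /= subn1.
    have jk : (ascending_index j < k)%N by rewrite ji prednK.
    rewrite ((eps_eq1 R (ascending_index j)).2 jk) => /eps_eq1 mk.
    rewrite -(E_pos a jk).2 -(E_pos a mk).2; apply: (E_antitone a_decr).
    by rewrite ji -ltnS prednK.
  have [jk|jk] := eqVneq (nat_of_ord j) k.
    left; apply: zero => m; have ji : (ascending_index j = k :> nat)%N.
      have -> : j = rshift k (Ordinal hl) by apply/val_inj; rewrite /= jk addn0.
      by rewrite ascending_index_rshift /= addn0.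
    have kj : (k <= ascending_index j)%N by rewrite ji.
    rewrite ((eps_eqN1 R (ascending_index j)).2 kj) => /eps_eqN1 km.
    rewrite -lerN2 -(E_neg a kj).2 -(E_neg a km).2; apply: (E_antitone a_decr).
    by rewrite ji.
  by right; split=> //; exists n.
move=> j s t ls lt st nocrit; apply: strictly_monotone_no_extremum => // [u|u su ext].
  rewrite in_itv /= => ut; apply: (coordinate_continuous a_gt0 a_decr T IL JL).
  exact: (lifetime_convex T ls lt).
by apply: (nocrit u su); left.
Qed.
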